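(* For each $n\in\mathbb{N}$ the probability generating function $G_n(z)=\sum_{k=1}^n\mathbb{P}(f_0(T_n)=k)\,z^k$ of the number $f_0(T_n)$ of vertices of the random convex chain $T_n$ is a polynomial of degree $n$ with precisely $n$ distinct real roots, all of them in $(-\infty,0]$.
   Context: Let $\mathbb{N}=\{1,2,\ldots\}$. Let $T\subset\mathbb{R}^2$ be the triangle with vertices $(0,0)$, $(0,1)$, $(1,0)$. For $n\in\mathbb{N}$ let $X_1,\ldots,X_n$ be independent random points uniformly distributed in $T$. The random convex chain $T_n$ is the convex hull of $X_1,\ldots,X_n$ together with $(0,1)$ and $(1,0)$. The random variable $f_0(T_n)$ is the number of vertices of $T_n$, where the two deterministic points $(0,1)$ and $(1,0)$ are not counted. Write $p_k^{(n)}:=\mathbb{P}(f_0(T_n)=k)$, $k=1,\ldots,n$. By a known result of Buchta (2006), $$p_k^{(n)}=2^k\sum_{i_1+\ldots+i_k=n}\frac{1}{i_1(i_1+i_2)\cdots(i_1+\ldots+i_k)}\cdot\frac{i_1\cdots i_k}{(i_1+1)(i_1+i_2+1)\cdots(i_1+\ldots+i_k+1)},$$ where the sum runs over all integers $i_1,\ldots,i_k\geq1$ with $i_1+\ldots+i_k=n$. *)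

(* Defs.v *)
From HB Require Import structures.
From mathcomp Require Import all_boot all_order all_algebra finmap.
From mathcomp Require Import all_classical all_reals all_analysis.

Set Implicit Arguments.
Unset Strict Implicit.
Unset Printing Implicit Defensive.

Import Order.TTheory GRing.Theory Num.Theory.

Local Open Scope classical_set_scope.
Local Open Scope ring_scope.
Local Open Scope convex_scope.

Notation plane R := (measurableTypeR R * measurableTypeR R)%type.

Definition area (R : realType) : set (plane R) -> \bar R :=
  (@lebesgue_measure R \x @lebesgue_measure R)%E.

(* [R^o * R^o] is convertible to [plane R] and carries the [lmodType R]
   structure that [convex_set] needs. *)
Definition convex_hull (R : realType) (A : set (plane R)) : set (plane R) :=
  smallest (@convex_set R (R^o * R^o)%type) A.

(* The vertices of a convex polygon are its extreme points. *)
Definition vertices (R : realType) (K : set (plane R)) : set (plane R) :=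
  [set x | K x /\
    forall (a b : convex_lmodType (R^o * R^o)%type) (t : {i01 R}),
      K a -> K b -> 0 < t%:num -> t%:num < 1 ->
      x = a <| t |> b -> a = x /\ b = x].

Definition triangle (R : realType) : set (plane R) :=
  convex_hull [set (0, 0); (0, 1); (1, 0)].
Arguments triangle R : clear implicits.

Definition convex_chain (R : realType) (n : nat) (x : 'I_n -> plane R) :
    set (plane R) :=
  convex_hull (range x `|` [set (0, 1); (1, 0)]).

(* [fset_set] returns the empty set on infinite sets; here its argument is
   always finite, the vertices of the hull being among the points spanning it. *)
Definition f0 (R : realType) (n : nat) (x : 'I_n -> plane R) : nat :=
  #|` fset_set (vertices (convex_chain x) `\` [set (0, 1); (1, 0)]) |%fset.

Definition mutually_independent d d' (Omega : measurableType d)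
    (E : measurableType d') (R : realType) (P : probability Omega R)
    (I : finType) (X : I -> {RV P >-> E}) : Prop :=
  forall (J : {set I}) (A : I -> set E), (forall i, measurable (A i)) ->
    P (\bigcap_(i in [set` J]) (X i @^-1` A i)) =
    (\prod_(i in J) P (X i @^-1` A i))%E.

Definition uniformly_distributed d (Omega : measurableType d) (R : realType)
    (P : probability Omega R) (D : set (plane R)) (X : {RV P >-> plane R}) :
    Prop :=
  forall A, measurable A ->
    distribution P X A = (area (A `&` D) * ((fine (area D))^-1)%:E)%E.

Definition prob_gen_fun d (Omega : measurableType d) (R : realType)
    (P : probability Omega R) (N : Omega -> nat) (n : nat) : {poly R} :=
  \sum_(1 <= k < n.+1) fine (P [set w | N w = k]) *: 'X^k.

(* Main.v *)
(* Buchta's formula is obtained by peeling off the first vertex of the chain.  Almost surely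
   exactly one of the n points, say x, has all the other points strictly to the right of the
   line from (0, 1) through x.  If this line meets the horizontal axis in (c, 0), the other
   points that can still be vertices are those of the triangle x, (c, 0), (1, 0); an affine map
   carries this triangle back to T and their law to the uniform law.  With c uniform on [0, 1]
   and an independent height, a Beta integral yields
     n (n + 1) G_n = 2 z sum_(l < n) (n - l) G_l.
   Taking second differences turns this into a three-term recurrence of orthogonal polynomial
   type, so that the roots of G_n / z interlace; they are simple, real and negative.

   Measurability of the number of vertices, needed also at degenerate configurations, comes
   from the fact that a point is a vertex of a convex polygon iff it is the unique minimum of
   a linear form on the spanning points, and that this form can be chosen rational. *)
Require Import Defs.
From HB Require Import structures.
From mathcomp Require Import all_boot all_order all_algebra finmap.
From mathcomp Require Import all_classical all_reals all_analysis.
From mathcomp Require Import measurable_realfun interval_inference.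
From mathcomp Require polyrcf.
From mathcomp Require Import ring lra zify.

Set Implicit Arguments.
Unset Strict Implicit.
Unset Printing Implicit Defensive.

Import Order.TTheory GRing.Theory Num.Theory.

Local Open Scope classical_set_scope.
Local Open Scope ring_scope.

(** * Interlacing roots from a convolution recursion *)

(** The kernel [n - l] has a geometric origin. If the first vertex has abscissa c and height y, each
    other point falls below the chord to (1, 0) with probability (1 - c) y, and above it but still
    to the right with probability (1 - c) (1 - y). The factors in c and y separate, and after
    multiplication with the binomial coefficient all factorials cancel but for one factor affine in
    l. As this factor is also affine in n, second differences remove the sum. The recursion links
    samples of different sizes, since the points above the chord are discarded. Expectations are
    therefore iterated integrals of functions on lists of arbitrary length, and not integrals over
    one fixed product space. *)

Lemma alternating_roots (R : rcfType) (p : {poly R}) (k : nat) (x : nat -> R) :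
  (forall i, (i < k)%N -> x i.+1 < x i) ->
  (forall i, (i <= k)%N -> 0 < (-1) ^+ i * p.[x i]) ->
  exists y : nat -> R, forall i, (i < k)%N -> x i.+1 < y i < x i /\ root p (y i).
Proof.
move=> xdec palt.
have /fin_all_exists [y yP] : forall i : 'I_k, exists y, x i.+1 < y < x i /\ root p y.
  move=> i; have := palt i (ltnW (ltn_ord i)); have := palt i.+1 (ltn_ord i).
  rewrite exprS mulN1r mulNr oppr_gt0 => pS pi.
  have xi := xdec _ (ltn_ord i).
  have [] := @polyrcf.poly_ivtoo _ ((-1) ^+ i *: p) _ _ (ltW xi).
    by rewrite !hornerZ nmulr_rlt0.
  move=> y; rewrite in_itv /= rootZ ?signr_eq0 // => yi ry.
  by exists y.
case: k => [|k] in xdec palt y yP *; first by exists x.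
exists (fun i => y (inord i)) => i ik.
by have := yP (inord i); rewrite inordK.
Qed.

(** Exactly the [j] factors with index below [j] are negative. *)
Lemma sign_prod_decreasing (R : realFieldType) (m j : nat) (r : nat -> R) (x : R) :
  (j <= m)%N -> (forall i, (i < j)%N -> x < r i) ->
  (forall i, (j <= i)%N -> (i < m)%N -> r i < x) ->
  0 < (-1) ^+ j * \prod_(i < m) (x - r i).
Proof.
move=> jm xr rx.
rewrite -(big_mkord xpredT (fun i => x - r i)) (@big_cat_nat _ _ _ j) //= mulrA.
apply: mulr_gt0; last first.
  by rewrite big_nat prodr_gt0 // => i /andP[? ?]; rewrite subr_gt0 rx.
rewrite -[j in (-1) ^+ j]subn0 -prodr_const_nat -big_split /= big_nat prodr_gt0 //.
by move=> i /andP[_ ij]; rewrite mulN1r opprB subr_gt0 xr.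
Qed.

(* For [m] > 0 the sign condition says that [q], of degree [m - 1], has exactly one root
   between two consecutive roots of [p]; the roots [r] are listed in decreasing order. *)
Definition interlaced (R : realFieldType) (m : nat) (q p : {poly R}) : Prop :=
  exists (r : nat -> R) (c : R),
  [/\ forall i, (i.+1 < m)%N -> r i.+1 < r i, 0 < c,
      p = c *: \prod_(i < m) ('X - (r i)%:P)
    & forall i, (i < m)%N -> 0 < (-1) ^+ i * q.[r i]].

Lemma decreasing_lt (R : realFieldType) (m : nat) (r : nat -> R) :
  (forall i, (i.+1 < m)%N -> r i.+1 < r i) ->
  forall i j, (i < j)%N -> (j < m)%N -> r j < r i.
Proof.
move=> rdec i; elim=> // j IHj; rewrite ltnS leq_eqVlt => /orP[/eqP-> /rdec//|ij jm].
exact: lt_trans (rdec _ jm) (IHj ij (ltnW jm)).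
Qed.

Lemma interlaced_size (R : realFieldType) (m : nat) (q p : {poly R}) :
  interlaced m q p -> size p = m.+1.
Proof.
case=> r [c [_ c0 -> _]]; rewrite size_scale ?gt_eqF // size_prod_XsubC.
by rewrite /index_enum -enumT size_enum_ord.
Qed.

Lemma interlaced_lead_gt0 (R : realFieldType) (m : nat) (q p : {poly R}) :
  interlaced m q p -> 0 < lead_coef p.
Proof.
case=> r [c [_ c0 -> _]].
by rewrite lead_coefZ (monicP _) ?mulr1 //; apply: monic_prod_XsubC.
Qed.

Lemma horner_interlaced (R : realFieldType) (m : nat) (r : nat -> R) c x :
  (c *: \prod_(i < m) ('X - (r i)%:P)).[x] = c * \prod_(i < m) (x - r i) :> R.
Proof.
by rewrite hornerZ horner_prod; congr (_ * _); apply: eq_bigr => i _; rewrite hornerXsubC.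
Qed.

Lemma poly_pinfty_gt0 (R : rcfType) (p : {poly R}) (x : R) : 0 < lead_coef p ->
  exists2 y, x < y & 0 < p.[y].
Proof.
move=> p0; have [y yP] := polyrcf.poly_pinfty_gt_lc p0.
exists (Num.max y (x + 1)); first by rewrite lt_max ltrDl ltr01 orbT.
by apply: lt_le_trans p0 (yP _ _); rewrite le_max lexx.
Qed.

Lemma poly_minfty_sign (R : rcfType) (p : {poly R}) (x : R) : 0 < lead_coef p ->
  exists2 y, y < x & 0 < (-1) ^+ (size p).-1 * p.[y].
Proof.
move=> p0; have [|y xy py] := @poly_pinfty_gt0 R ((-1) ^+ (size p).-1 *: (p \Po (- 'X))) (- x).
  rewrite lead_coefZ lead_coef_comp ?size_polyN ?size_polyX // lead_coefN lead_coefX.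
  by rewrite mulrCA -exprMn mulrNN mulr1 expr1n mulr1.
exists (- y); first by rewrite ltrNl.
by move: py; rewrite hornerZ horner_comp hornerN hornerX.
Qed.

(** At a root of [p] the new polynomial equals [- g * q], whose sign alternates from root to root by
    interlacing. Together with the signs far to the right and far to the left this gives [m.+2]
    alternating values, hence [m.+1] roots, as many as the degree allows, and they are separated by
    the roots of [p]. *)
Lemma interlaced_next (R : rcfType) (m : nat) (q p : {poly R}) (a b g : R) :
  interlaced m q p -> (size q <= m.+1)%N -> 0 < b -> 0 < g ->
  interlaced m.+1 p ((a%:P + b *: 'X) * p - g *: q).
Proof.
move=> qp sq b0 g0; have sp := interlaced_size qp; have lp := interlaced_lead_gt0 qp.
have sabX : size (a%:P + b *: 'X) = 2%N.
  rewrite addrC size_addl size_scale ?gt_eqF // size_polyX //.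
  by rewrite (leq_ltn_trans (size_polyC_leq1 _)).
have labX : lead_coef (a%:P + b *: 'X) = b.
  rewrite addrC lead_coefDl; first by rewrite lead_coefZ lead_coefX mulr1.
  by rewrite size_scale ?gt_eqF // size_polyX (leq_ltn_trans (size_polyC_leq1 _)).
have p_neq0 : p != 0 by rewrite -lead_coef_eq0 gt_eqF.
have abX_neq0 : a%:P + b *: 'X != 0 by rewrite -size_poly_gt0 sabX.
set P := _ - _.
have sq' : (size (- (g *: q))%R < size ((a%:P + b *: 'X) * p)%R)%N.
  by rewrite size_polyN size_scale ?gt_eqF // size_mul // sp sabX.
have sP : size P = m.+2 by rewrite size_addl // size_mul // sp sabX.
have lP : 0 < lead_coef P by rewrite lead_coefDl // lead_coefM labX mulr_gt0.
case: qp => r [c [rdec c0 pE qr]].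
have r_dec := decreasing_lt rdec.
have pr i : (i < m)%N -> p.[r i] = 0.
  by move=> im; rewrite pE horner_interlaced (bigD1 (Ordinal im)) //= subrr mul0r mulr0.
have [y0 ry0 Py0] := poly_pinfty_gt0 (r 0%N) lP.
have [y1 ry1] := poly_minfty_sign (Num.min y0 (r m.-1)) lP.
rewrite sP /= => Py1; move: ry1; rewrite lt_min => /andP[y10 y1r].
(* The test points, in decreasing order: [y0], the roots of [p], [y1]. For [m = 0] there is no root
   in between, which is why [y1] was also chosen below [y0]. *)
pose x i := if i is j.+1 then if (j < m)%N then r j else y1 else y0.
have [| |s sP'] := @alternating_roots R P m.+1 x.
- case=> [_|i]; rewrite /x; first by case: ifP.
  rewrite ltnS => im; rewrite im; case: ifPn => [/rdec//|].
  by rewrite -leqNgt => mi; rewrite (_ : i = m.-1) //; lia.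
- case=> [_|i]; rewrite /x ?mul1r //.
  rewrite ltnS leq_eqVlt => /orP[/eqP->|im]; first by rewrite ltnn.
  rewrite im /P hornerD hornerM pr // mulr0 add0r hornerN hornerZ exprS mulN1r.
  by rewrite mulrNN mulrCA mulr_gt0 // qr.
have xle i : (i <= m)%N -> x i.+1 < s i < x i by rewrite -ltnS => /sP'[].
have sdec i : (i.+1 < m.+1)%N -> s i.+1 < s i.
  move=> im; have /andP[_ h1] := xle i.+1 im; have /andP[h2 _] := xle i (ltnW im).
  exact: lt_trans h1 h2.
exists s, (lead_coef P); split => //.
(* The [m.+1] distinct roots exhaust the degree, so [P] splits with its leading coefficient as
   constant. *)
- have := @all_roots_prod_XsubC R P [seq s (val i) | i : 'I_m.+1].
  rewrite big_image /=; apply.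
  + by rewrite size_image card_ord sP.
  + by apply/allP => _ /fintype.imageP[i _ ->]; have [] := sP' i (ltn_ord i).
  rewrite uniq_rootsE map_inj_uniq ?enum_uniq // => i j sij.
  apply/val_inj/eqP; rewrite eqn_leq; apply/andP; split; rewrite leqNgt; apply/negP => ij;
  by have := decreasing_lt sdec ij (ltn_ord _); rewrite sij ltxx.
- move=> j; rewrite ltnS => jm; have /andP[sj sj'] := xle j jm.
  rewrite pE horner_interlaced mulrCA mulr_gt0 // sign_prod_decreasing //.
  + case: j jm sj sj' => // j jm _; rewrite /x jm => sj i.
    rewrite ltnS leq_eqVlt => /orP[/eqP->//|ij].
    exact: lt_trans sj (r_dec _ _ ij jm).
  + move=> i; rewrite leq_eqVlt => /orP[/eqP<- im|ji im]; first by move: sj; rewrite /x im.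
    by apply: lt_trans (r_dec _ _ ji im) _; move: sj; rewrite /x (ltn_trans ji im).
Qed.

(* Subtracting twice consecutive instances of the convolution recursion. *)
Lemma second_difference (R : comNzRingType) (G : nat -> {poly R}) (n : nat) :
  (forall n, (n * n.+1)%:R * G n = 2%:R * 'X * \sum_(l < n) (n - l)%:R * G l) ->
  (n.+2 * n.+3)%:R * G n.+2 =
  ((2 * n.+1 * n.+2)%:R + 2%:R * 'X) * G n.+1 - (n * n.+1)%:R * G n.
Proof.
move=> GE; have E0 := GE n; have E1 := GE n.+1; have E2 := GE n.+2.
pose S := \sum_(l < n) (n - l)%:R * G l; pose S' := \sum_(l < n) G l.
(* Each increment of [n] raises the kernel by 1 and so adds the plain sum [S']. In the second
   difference both [S] and [S'] cancel, and only [G n.+1] is left. *)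
have S1 : \sum_(l < n.+1) (n.+1 - l)%:R * G l = S + S' + G n.
  rewrite big_ord_recr /= subSnn mul1r -big_split /=; congr (_ + _).
  apply: eq_bigr => i _; rewrite subSn ?(ltnW (ltn_ord i)) // -[_.+1]addn1 natrD.
  by rewrite mulrDl mul1r.
have S2 : \sum_(l < n.+2) (n.+2 - l)%:R * G l = S + 2%:R * S' + 2%:R * G n + G n.+1.
  rewrite !big_ord_recr /= subSnn mul1r (_ : (n.+2 - n = 2)%N); last by lia.
  congr (_ + _ + _); rewrite mulr_sumr -big_split /=; apply: eq_bigr => i _.
  rewrite (_ : (n.+2 - i = n - i + 2)%N); last by have := ltn_ord i; lia.
  by rewrite natrD mulrDl.
have -> : (2 * n.+1 * n.+2)%:R = 2%:R * (n.+1 * n.+2)%:R :> {poly R}.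
  by rewrite -natrM mulnA.
rewrite [X in X - _]mulrDl -2!mulrA E0 E1 E2 S1 S2 -/S; ring.
Qed.

Lemma scale_natr (R : nzRingType) (n : nat) (p : {poly R}) : n%:R *: p = n%:R * p.
Proof. by rewrite scaler_nat mulr_natl. Qed.

Section ConvolutionRoots.
Context (R : rcfType) (G : nat -> {poly R}).
Hypothesis G0 : G 0%N = 1.
Hypothesis GE : forall n, (n * n.+1)%:R * G n = 2%:R * 'X * \sum_(l < n) (n - l)%:R * G l.

(** The quotient of [G n.+1] by ['X], read off from the recursion so that no division of polynomials
    is needed. *)
Let K n := (2%:R / (n.+1 * n.+2)%:R) *: \sum_(l < n.+1) (n.+1 - l)%:R * G l.

Let GK n : G n.+1 = 'X * K n.
Proof.
have nz : (n.+1 * n.+2)%:R != 0 :> R by rewrite pnatr_eq0.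
apply: (scalerI nz); rewrite scale_natr GE /K -scalerAr scalerA mulrCA divff // mulr1.
by rewrite scale_natr mulrA.
Qed.

(** The term [l = 0] is a positive constant and the others are nonnegative. Hence the root 0 of
    [G n.+1] is simple and all the other real roots are negative. *)
Let K_gt0 n x : 0 <= x -> 0 < (K n).[x].
Proof.
move=> x0; elim/ltn_ind: n => n IHn.
rewrite hornerZ mulr_gt0 ?divr_gt0 ?ltr0n // horner_sum big_ord_recl /= G0 mulr1.
rewrite -polyC_natr hornerC ltr_wpDr ?ltr0n // sumr_ge0 // => i _.
rewrite -polyC_natr hornerM hornerC mulr_ge0 ?ler0n // GK hornerM hornerX.
by rewrite mulr_ge0 // ltW // IHn.
Qed.

(** The recurrence for [G] divided by ['X]. For [n = 0] the term [G 0] is not divisible by ['X], but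
    its coefficient vanishes, so 0 can stand for the missing predecessor of [K 0]. *)
Let Krec n : K n.+1 = (((2 * n.+1 * n.+2)%:R / (n.+2 * n.+3)%:R)%:P +
    (2%:R / (n.+2 * n.+3)%:R) *: 'X) * K n
  - ((n * n.+1)%:R / (n.+2 * n.+3)%:R) *: (if n is m.+1 then K m else 0).
Proof.
have nz : (n.+2 * n.+3)%:R != 0 :> R by rewrite pnatr_eq0.
apply: (scalerI nz); apply: (mulfI (_ : 'X != 0)); first by rewrite polyX_eq0.
rewrite -[in LHS]scalerAr -GK scale_natr (second_difference _ GE) GK.
have cancel x : (n.+2 * n.+3)%:R * (x / (n.+2 * n.+3)%:R) = x :> R.
  by rewrite mulrCA divff // mulr1.
rewrite scalerBr mulrBr scalerAl scalerDr -[in RHS]mul_polyC -polyCM cancel.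
rewrite [(_ *: (_ *: 'X))]scalerA cancel [X in _ = _ - 'X * X]scalerA cancel.
rewrite polyC_natr !scale_natr; congr (_ - _); first by rewrite mulrCA.
by rewrite mulrCA; case: n {nz cancel} => [|n]; rewrite ?mul0n ?mul0r ?GK.
Qed.

Let Kinterlaced n : interlaced n (if n is m.+1 then K m else 0) (K n).
Proof.
have K0 : K 0 = 1.
  by rewrite /K big_ord1 G0 !mulr1 divff ?pnatr_eq0 // scale1r.
elim/ltn_ind: n => -[_|n IHn].
  by exists (fun _ => 0), 1; split; rewrite ?ltr01 // big_ord0 K0 scale1r.
rewrite Krec; case: n IHn => [|n] IHn.
  (* The true coefficient is 0 here, but [interlaced_next] asks for a positive one; as the
     predecessor is 0, the coefficient 1 does. *)
  rewrite scaler0 -[0](scaler0 _ 1).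
  by apply: (interlaced_next _ (IHn 0%N _)); rewrite ?size_poly0 ?divr_gt0 ?ltr01 ?ltr0n.
apply: (interlaced_next _ (IHn n.+1 _)); rewrite ?divr_gt0 ?ltr0n //.
by rewrite (interlaced_size (IHn n _)) // ltnW.
Qed.

Lemma convolution_recursion_real_rooted n : (0 < n)%N ->
  size (G n) = n.+1 /\
  exists s : seq R, [/\ size s = n, uniq s, forall x, root (G n) x = (x \in s)
    & forall x, x \in s -> x <= 0].
Proof.
case: n => // n _; have sK := interlaced_size (Kinterlaced n).
have [r [c [rdec c0 KE _]]] := Kinterlaced n.
have rootK x : root (K n) x = (x \in [seq r (val i) | i : 'I_n]).
  rewrite KE rootZ ?gt_eqF // -root_prod_XsubC; congr root.
  by rewrite big_image.
have K_neg x : root (K n) x -> x < 0.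
  by move=> rx; rewrite ltNge; apply/negP => /(K_gt0 n); rewrite (rootP rx) ltxx.
split; first by rewrite GK mulrC size_mulX ?sK // -size_poly_gt0 sK.
exists (0 :: [seq r (val i) | i : 'I_n]); split.
- by rewrite /= size_image card_ord.
- rewrite /= -rootK; apply/andP; split; first by apply/negP => /K_neg; rewrite ltxx.
  rewrite map_inj_uniq ?enum_uniq // => i j rij.
  apply/val_inj/eqP; rewrite eqn_leq; apply/andP; split; rewrite leqNgt; apply/negP => ij;
  by have := decreasing_lt rdec ij (ltn_ord _); rewrite rij ltxx.
- by move=> x; rewrite GK rootM rootX in_cons rootK.
- by move=> x; rewrite in_cons -rootK => /orP[/eqP->//|/K_neg/ltW].
Qed.

End ConvolutionRoots.

(** * Vertices of a planar convex hull *)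

Local Open Scope convex_scope.

Definition dotp (R : realType) (u : R * R) (v : plane R) : R := u.1 * v.1 + u.2 * v.2.

Lemma convE (R : realType) (a b : convex_lmodType (R^o * R^o)%type) (t : {i01 R}) :
  a <| t |> b = (t%:num * a.1 + (1 - t%:num) * b.1, t%:num * a.2 + (1 - t%:num) * b.2)
  :> plane R.
Proof. by []. Qed.

Lemma dotp_conv (R : realType) (u : R * R) (a b : convex_lmodType (R^o * R^o)%type)
    (t : {i01 R}) :
  dotp u (a <| t |> b) = t%:num * dotp u a + (1 - t%:num) * dotp u b.
Proof. rewrite convE /dotp /=; ring. Qed.

Lemma convex_setE (R : realType) (K : set (plane R)) :
  @convex_set R (R^o * R^o)%type K <->
  forall a b (l : R), K a -> K b -> 0 < l < 1 ->
    K (l * a.1 + (1 - l) * b.1, l * a.2 + (1 - l) * b.2).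
Proof.
rewrite convex_setW; split=> [cK a b l Ka Kb /andP[l0 l1]|cK a b].
  have l01 : 0 <= l <= 1 by rewrite !ltW.
  have := cK a b (mem_set Ka) (mem_set Kb) (Itv01 (ltW l0) (ltW l1)) l0 l1.
  by rewrite inE.
rewrite !inE => Ka Kb k k0 k1; rewrite convE.
by rewrite inE; apply: cK => //; rewrite k0 k1.
Qed.

Lemma finite_gap (R : realFieldType) (T : eqType) (s : seq T) (f : T -> R) (b : R) :
  {in s, forall q, f q < b} -> exists2 a, a < b & {in s, forall q, f q < a}.
Proof.
elim: s => [_|q s IHs sb]; first by exists (b - 1) => //; rewrite ltrBlDr ltrDl ltr01.
have [|a ab sa] := IHs; first by move=> p ps; apply: sb; rewrite in_cons ps orbT.
have qb : f q < b by apply: sb; rewrite mem_head.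
exists (Num.max a ((f q + b) / 2)).
  by rewrite gt_max ab /=; lra.
move=> p; rewrite in_cons lt_max => /orP[/eqP->|/sa->//].
by apply/orP; right; lra.
Qed.

Lemma finite_bound (R : realFieldType) (T : eqType) (s : seq T) (f : T -> R) :
  exists a, {in s, forall q, f q < a}.
Proof.
elim: s => [|q s [a sa]]; first by exists 0.
exists (Num.max a (f q + 1)) => p; rewrite in_cons lt_max => /orP[/eqP->|/sa->//].
by rewrite ltrDl ltr01 orbT.
Qed.

Lemma convex_set_avg (R : realType) (K : set (plane R)) (p q : plane R) (a b : R) :
  @convex_set R (R^o * R^o)%type K -> K p -> K q -> 0 <= a -> 0 <= b -> 0 < a + b ->
  K ((a * p.1 + b * q.1) / (a + b), (a * p.2 + b * q.2) / (a + b)).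
Proof.
move=> /convex_setE cK Kp Kq a0 b0 ab0; have ab_neq0 : a + b != 0 by rewrite gt_eqF.
have [a_eq0|a_neq0] := eqVneq a 0.
  rewrite a_eq0 !mul0r !add0r in ab_neq0 *.
  by rewrite ![b * _]mulrC !mulfK //; case: q Kq.
have [b_eq0|b_neq0] := eqVneq b 0.
  rewrite b_eq0 !mul0r !addr0 in ab_neq0 *.
  by rewrite ![a * _]mulrC !mulfK //; case: p Kp.
have ap : 0 < a by rewrite lt_def a_neq0.
have bp : 0 < b by rewrite lt_def b_neq0.
have := cK _ _ (a / (a + b)) Kp Kq.
rewrite divr_gt0 //= ltr_pdivrMr // mul1r ltrDl bp => /(_ isT).
congr (K _); congr pair; by field.
Qed.

(* Gordan's alternative, by induction on [s]: if [u] separates [v] from [s] but not from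
   [q0], the segments from [q0] to the points of [s] meet the line through [v] orthogonal
   to [u]; either they meet it on both sides of [v], which puts [v] in the hull, or on one
   side only, and then [u] can be tilted. *)
Lemma separation_or_hull (R : realType) (s : seq (plane R)) (v : plane R) :
  (exists u, {in s, forall q, dotp u v < dotp u q}) \/
  (forall K, @convex_set R (R^o * R^o)%type K -> {in s, forall q, K q} -> K v).
Proof.
elim: s => [|q0 s [[u us]|IHs]]; first by left; exists (0, 0).
  2: by right=> K cK sK; apply: IHs => // q qs; apply: sK; rewrite in_cons qs orbT.
(* A point [q1] in the tail is needed below: it forces [u] to be nonzero, and it fixes the sign of
   [de q0] when [q0] lies on the line through [v]. *)
case: s => [|q1 s1] in us *.
  have [->|q0v] := eqVneq q0 v.
    by right => K _; apply; rewrite mem_head.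
  left; exists (q0.1 - v.1, q0.2 - v.2) => q; rewrite inE => /eqP->.
  have : 0 < (q0.1 - v.1) ^+ 2 + (q0.2 - v.2) ^+ 2 :> R.
    rewrite lt_def addr_ge0 ?sqr_ge0 // andbT paddr_eq0 ?sqr_ge0 // !sqrf_eq0 !subr_eq0.
    by apply: contra q0v; case: q0 v {u us} => ? ? [? ?] /= /andP[/eqP-> /eqP->].
  by rewrite /dotp /=; lra.
have q1s : q1 \in q1 :: s1 by rewrite mem_head.
set s := q1 :: s1 in us q1s *.
have [al|al] := ltP (dotp u v) (dotp u q0).
  by left; exists u => q; rewrite in_cons => /orP[/eqP->|/us].
pose a := dotp u v - dotp u q0; have a0 : 0 <= a by rewrite subr_ge0.
pose e : R * R := (- u.2, u.1).
pose be q := dotp u q - dotp u v; pose de q := dotp e q - dotp e v.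
have be0 q : q \in s -> 0 < be q by move/us; rewrite subr_gt0.
(* Up to the positive factor [a + be q], this is the coordinate along [e], relative to [v], of the
   point where the segment from [q0] to [q] meets the line through [v] orthogonal to [u]. *)
pose ta q := be q * de q0 + a * de q.
have n0 : 0 < u.1 ^+ 2 + u.2 ^+ 2.
  rewrite lt_def addr_ge0 ?sqr_ge0 // andbT paddr_eq0 ?sqr_ge0 // !sqrf_eq0.
  apply/negP => /andP[/eqP u1 /eqP u2].
  by have := us _ q1s; rewrite /dotp u1 u2 !mul0r addr0 ltxx.
have n_neq0 : u.1 ^+ 2 + u.2 ^+ 2 != 0 by rewrite gt_eqF.
(* The new form is [l * u + d * e]. The points of [s] bound [l] from below and [q0] bounds it from
   above, by [d * de q0 / a] if [a] is nonzero; the sign of [d * ta q] says that the lower bounds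
   are smaller than the upper one. *)
have tilt (d : R) : {in s, forall q, 0 < d * ta q} ->
    exists u', {in q0 :: s, forall q, dotp u' v < dotp u' q}.
  move=> dta.
  have dotE l q : dotp (l * u.1 + d * e.1, l * u.2 + d * e.2) q -
      dotp (l * u.1 + d * e.1, l * u.2 + d * e.2) v = l * be q + d * de q.
    rewrite /be /de /dotp /=; ring.
  suff [l l0 ls] : exists2 l, 0 < - l * a + d * de q0 &
      {in s, forall q, - (d * de q / be q) < l}.
    exists (l * u.1 + d * e.1, l * u.2 + d * e.2) => q.
    rewrite in_cons -subr_gt0 dotE => /orP[/eqP->|qs].
      by apply: lt_le_trans l0 _; rewrite /be /a; lra.
    have := ls _ qs; rewrite -(ltr_pM2r (be0 _ qs)) mulNr divfK ?gt_eqF ?be0 //; lra.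
  have [a_eq0|a_neq0] := eqVneq a 0.
    have [l ls] := finite_bound s (fun q => - (d * de q / be q)); exists l => //.
    have := dta _ q1s; rewrite /ta a_eq0 mul0r addr0 mulr0 add0r mulrCA.
    by rewrite pmulr_rgt0 ?be0.
  have ap : 0 < a by rewrite lt_def a_neq0.
  have [|l lb ls] := @finite_gap _ _ s (fun q => - (d * de q / be q)) (d * de q0 / a).
    move=> q qs; rewrite ltrNl -subr_gt0 opprK.
    have -> : d * de q / be q + d * de q0 / a = (d * ta q) / (a * be q).
      by rewrite /ta; field; rewrite a_neq0 gt_eqF ?be0.
    by rewrite divr_gt0 ?dta // mulr_gt0 // be0.
  exists l => //; move: lb; rewrite ltr_pdivlMr //; lra.
have [/hasP[p ps tp]|/hasPn neg] := boolP (has (fun q => ta q <= 0) s); last first.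
  by left; apply: (tilt 1) => q /neg; rewrite -ltNge mul1r.
have [/hasP[p' ps' tp']|/hasPn neg'] := boolP (has (fun q => 0 <= ta q) s); last first.
  by left; apply: (tilt (- 1)) => q /neg'; rewrite -ltNge mulN1r oppr_gt0.
right=> K cK sK.
have avgK q : q \in s -> K (v.1 - u.2 * ((ta q / (a + be q)) / (u.1 ^+ 2 + u.2 ^+ 2)),
                           v.2 + u.1 * ((ta q / (a + be q)) / (u.1 ^+ 2 + u.2 ^+ 2))).
  move=> qs; have ab0 : 0 < a + be q by rewrite ltr_wpDl ?be0.
  have Kq0 : K q0 by apply: sK; rewrite mem_head.
  have Kq : K q by apply: sK; rewrite in_cons qs orbT.
  have := convex_set_avg cK Kq Kq0 a0 (ltW (be0 _ qs)) ab0.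
  have ab_neq0 : a + be q != 0 by rewrite gt_eqF.
  congr (K _); congr pair; move: ab_neq0 n_neq0; rewrite /ta /a /be /de /dotp /= => ? ?; field;
  exact/andP.
have [tp_eq0|tp_neq0] := eqVneq (ta p) 0.
  by have := avgK _ ps; rewrite tp_eq0 !mul0r !mulr0 subr0 addr0; case: (v).
have abp : 0 < a + be p by rewrite ltr_wpDl ?be0.
have abp' : 0 < a + be p' by rewrite ltr_wpDl ?be0.
have tpn : ta p < 0 by rewrite lt_def eq_sym tp_neq0.
have := avgK _ ps; have := avgK _ ps'.
have : ta p / (a + be p) < 0 by rewrite pmulr_llt0 ?invr_gt0.
have : 0 <= ta p' / (a + be p') by rewrite divr_ge0 ?(ltW abp').
move: (ta p / _) (ta p' / _) => x y y0 x0 Ky Kx.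
have xy0 : 0 < y + (- x) by rewrite ltr_wpDl ?oppr_gt0.
have Nx0 : 0 <= - x by rewrite oppr_ge0 ltW.
(* The two crossing points have offsets [x] and [y] of opposite signs along [e]; the weights [y] and
   [- x] make the mean offset vanish. *)
have := convex_set_avg cK Kx Ky y0 Nx0 xy0.
rewrite [v in K v -> _](_ : _ = v) //=; case: (v) => v1 v2 /=.
by congr pair; field; rewrite n_neq0 gt_eqF.
Qed.

Lemma convex_hull_sub (R : realType) (F : set (plane R)) : F `<=` convex_hull F.
Proof. exact: sub_smallest. Qed.

Lemma convex_hull_convex (R : realType) (F : set (plane R)) :
  @convex_set R (R^o * R^o)%type (convex_hull F).
Proof.
apply/convex_setE => a b l Fa Fb l01 K [cK FK].
by move/convex_setE: (cK); apply => //; [exact: Fa|exact: Fb].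
Qed.

Definition exposed (R : realType) (F : set (plane R)) (v : plane R) : Prop :=
  exists u, forall q, F q -> q <> v -> dotp u v < dotp u q.

(** If [v] is extreme, the hull without [v] is still convex. Were [v] missing from [s] or in the
    hull of the other points, that smaller set would have to contain [v]. Conversely, the points
    where the exposing form is larger than at [v], together with [v], form a convex set containing
    [s], and no proper segment inside it passes through [v]. *)
Lemma vertex_exposed (R : realType) (s : seq (plane R)) (v : plane R) :
  vertices (convex_hull [set` s]) v <-> v \in s /\ exposed [set` s] v.
Proof.
split=> [[hv ext]|[vs [u uv]]].
  have cK : @convex_set R (R^o * R^o)%type (convex_hull [set` s] `\ v).
    apply/convex_setW => a b; rewrite !inE => -[ha av] [hb bv] k k0 k1; rewrite inE.
    split; first by have := @convex_hull_convex R [set` s] a b k (mem_set ha) (mem_set hb); rewrite inE.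
    by move=> abv; have [] := ext _ _ k ha hb k0 k1 (esym abv).
  split.
    apply/negPn/negP => vs; suff : (convex_hull [set` s] `\ v) v by move=> [_ /(_ erefl)].
    apply: (hv (convex_hull [set` s] `\ v)); split=> [|q qs]; first exact: cK.
    split; first exact: convex_hull_sub.
    by move=> qv; move: vs; rewrite -(qv : q = v) (qs : q \in s).
  have [[u us]|hK] := separation_or_hull [seq q <- s | q != v] v.
    by exists u => q qs /eqP qv; apply: us; rewrite mem_filter qv.
  have [|_ /(_ erefl)//] := hK _ cK.
  move=> q; rewrite mem_filter => /andP[/eqP qv qs].
  by split => //; apply: convex_hull_sub.
split; first exact: convex_hull_sub.
have below q : convex_hull [set` s] q -> dotp u v < dotp u q \/ q = v.
  move=> hq; apply: (hq [set q | dotp u v < dotp u q \/ q = v]); split=> [|p ps /=]; last first.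
    by have [->|/eqP pv] := eqVneq p v; [right|left; apply: uv].
  apply/convex_setW => a b; rewrite !inE => ha hb k k0 k1; rewrite inE.
  by case: ha => [ha|->]; case: hb => [hb|->]; last (by right; rewrite convmm);
    left; rewrite dotp_conv; nra.
move=> a b t /below ha /below hb t0 t1 abv.
have {abv} E : dotp u v = t%:num * dotp u a + (1 - t%:num) * dotp u b.
  by rewrite -dotp_conv -abv.
move: t%:num t0 t1 E => {}t t0 t1 E.
case: ha => [ha|av]; case: hb => [hb|bv] //; exfalso.
- nra.
- by rewrite bv in E; clear bv below; nra.
- by rewrite av in E; clear av below; nra.
Qed.

Local Close Scope convex_scope.

(** * The first vertex of a convex chain *)

Definition chain_vertex (R : realType) (s : seq (plane R)) (v : plane R) : bool :=
  [&& v != (0, 1), v != (1, 0) & `[< exposed [set` [:: (0, 1), (1, 0) & s]] v >]].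

(** [undup] makes the count depend on the set of points only, as the cardinal in [f0] does, even
    when points of the sample coincide. *)
Definition vertex_count (R : realType) (s : seq (plane R)) : nat :=
  count (chain_vertex s) (undup s).

Lemma f0_vertex_count (R : realType) (n : nat) (x : 'I_n -> plane R) :
  f0 x = vertex_count [seq x i | i : 'I_n].
Proof.
pose s := [seq x i | i : 'I_n].
have hullE : range x `|` [set (0, 1); (1, 0)] = [set` [:: (0, 1), (1, 0) & s]].
  apply/seteqP; split=> q /=; rewrite !in_cons.
    case=> [[i _ <-]|[->|->]]; rewrite ?eqxx ?orbT //.
    by rewrite map_f ?orbT // mem_enum.
  by case/or3P => [/eqP|/eqP|/mapP[i _]] ->; [right; left|right; right|left; exists i].
have -> : f0 x = #|` [fset v in [seq v <- s | chain_vertex s v]]|%fset.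
  rewrite /f0 /convex_chain hullE -[in RHS](@set_fsetK _ [fset v in _]%fset).
  congr (#|` fset_set _|%fset); apply/seteqP; split=> v /=.
    rewrite !inE mem_filter; case=> /vertex_exposed[vs ev] /not_orP[vA vC].
    rewrite !in_cons in vs; case/or3P: vs => [/eqP//|/eqP//|vs]; rewrite vs andbT.
    by apply/and3P; split; [exact/eqP|exact/eqP|exact/asboolP].
  rewrite !inE mem_filter => /andP[/and3P[/eqP vA /eqP vC /asboolP ev] vs].
  by split; [apply/vertex_exposed; rewrite !in_cons vs !orbT|case].
by rewrite card_fseq -filter_undup size_filter.
Qed.

Lemma vertex_count_eq_mem (R : realType) (s t : seq (plane R)) :
  s =i t -> vertex_count s = vertex_count t.
Proof.
move=> st; rewrite /vertex_count.
have st' : chain_vertex s = chain_vertex t.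
  apply/funext => v; rewrite /chain_vertex; congr [&& _, _ & `[< exposed _ v >]].
  by apply/seteqP; split=> q /=; rewrite !in_cons st.
rewrite st'; apply/permP; apply: uniq_perm; rewrite ?undup_uniq // => q.
by rewrite !mem_undup.
Qed.

Definition open_triangle (R : realType) (p : plane R) : bool :=
  [&& 0 < p.1 :> R, 0 < p.2 :> R & p.1 + p.2 < 1 :> R].

(* The affine map that fixes (0, 1) and (1, 0) and sends (c, 0) to the origin. *)
Definition shear (R : realType) (c : R) (p : plane R) : plane R :=
  ((p.1 - c + c * p.2) / (1 - c), p.2).

(** Meant to follow [shear], with [b] the height of the first vertex: it maps the triangle (0, 0),
    (0, b), (1, 0) onto T and sends (0, b) to (0, 1). *)
Definition vscale (R : realType) (b : R) (p : plane R) : plane R := (p.1, p.2 / b : R).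

Lemma shear_inj (R : realType) (c : R) : c < 1 -> injective (shear c).
Proof.
move=> c1 [p1 p2] [q1 q2] [/= + pq2]; rewrite pq2 => /mulIf; rewrite invr_eq0 gt_eqF ?subr_gt0 //.
by move=> /(_ isT) /addIr/addIr ->.
Qed.

Lemma vscale_inj (R : realType) (b : R) : 0 < b -> injective (vscale b).
Proof. by move=> b0 [p1 p2] [q1 q2] [/= -> /mulIf->] //; rewrite invr_eq0 gt_eqF. Qed.

(** Linear forms are carried along by the transpose of the linear part; the translation part cancels
    when two values are compared. *)
Lemma exposed_shear (R : realType) (c : R) (F : set (plane R)) (v : plane R) : c < 1 ->
  exposed (shear c @` F) (shear c v) <-> exposed F v.
Proof.
move=> c1; have c1_neq0 : 1 - c != 0 by rewrite gt_eqF // subr_gt0.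
split=> -[u uv].
  exists (u.1 / (1 - c), u.1 * c / (1 - c) + u.2) => q Fq qv.
  have := uv _ (imageP _ Fq) (contra_not (@shear_inj _ _ c1 _ _) qv).
  rewrite /dotp /shear /= -subr_gt0 => uvq; rewrite -subr_gt0; move: uvq; congr (0 < _); ring.
exists (u.1 * (1 - c), u.2 - u.1 * c) => _ [q Fq <-] qv.
have := uv _ Fq (contra_not (@congr1 _ _ (shear c) _ _) qv).
by rewrite /dotp /shear /= -subr_gt0 => uvq; rewrite -subr_gt0; move: uvq; congr (0 < _); field.
Qed.

Lemma exposed_vscale (R : realType) (b : R) (F : set (plane R)) (v : plane R) : 0 < b ->
  exposed (vscale b @` F) (vscale b v) <-> exposed F v.
Proof.
move=> b0; have b_neq0 : b != 0 by rewrite gt_eqF.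
split=> -[u uv].
  exists (u.1, u.2 / b) => q Fq qv.
  have := uv _ (imageP _ Fq) (contra_not (@vscale_inj _ _ b0 _ _) qv).
  by rewrite /dotp /vscale /= !(mulrAC _ _^-1) -!(mulrA u.2).
exists (u.1, u.2 * b) => _ [q Fq <-] qv.
have := uv _ Fq (contra_not (@congr1 _ _ (vscale b) _ _) qv).
rewrite /dotp /vscale /= -subr_gt0 => uvq; rewrite -subr_gt0; move: uvq; congr (0 < _); field.
exact: b_neq0.
Qed.

Lemma image_seq (T U : eqType) (f : T -> U) (s : seq T) : f @` [set` s] = [set` map f s].
Proof.
apply/seteqP; split=> q /=; first by case=> p ps <-; apply: map_f.
by case/mapP => p ps ->; exists p.
Qed.

Lemma vertex_count_shear (R : realType) (c : R) (s : seq (plane R)) : c < 1 ->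
  vertex_count (map (shear c) s) = vertex_count s.
Proof.
move=> c1; have c1_neq0 : 1 - c != 0 by rewrite gt_eqF // subr_gt0.
have shA : shear c (0, 1) = (0, 1) by rewrite /shear /= sub0r mulr1 addNr mul0r.
have shC : shear c (1, 0) = (1, 0) by rewrite /shear /= mulr0 addr0 divff.
rewrite /vertex_count undup_map_inj; last exact: shear_inj.
rewrite count_map; apply: eq_count => v; rewrite /= /chain_vertex.
rewrite -(inj_eq (shear_inj c1) v) shA -(inj_eq (shear_inj c1) v) shC.
congr [&& _, _ & _]; apply: asbool_equiv_eq.
have -> : [set` [:: (0, 1), (1, 0) & map (shear c) s]] =
    shear c @` [set` [:: (0, 1), (1, 0) & s]] by rewrite image_seq /= shA shC.
exact: exposed_shear.
Qed.

(** The point (0, b) is a vertex and takes over the role of (0, 1). A point of T on or above the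
    chord from (0, b) to (1, 0) lies in the hull of (0, b), (1, 0), (0, 1), hence is no vertex. For
    [p] below the chord, a form exposing [p] among (0, b), (1, 0) and the points below is positive
    at [p], and therefore larger at every point on or above the chord: those points impose no
    further condition. *)
Lemma vertex_count_vscale (R : realType) (b : R) (s : seq (plane R)) : 0 < b < 1 ->
  all (@open_triangle R) s ->
  vertex_count ((0, b) :: s) =
  (vertex_count [seq vscale b q | q <- s & open_triangle (vscale b q)]).+1.
Proof.
move=> /andP[b0 b1] /allP sT; have b_neq0 : b != 0 by rewrite gt_eqF.
pose T' q := open_triangle (vscale b q).
have scA : vscale b (0, b) = (0, 1) by rewrite /vscale /= divff.
have scC : vscale b (1, 0) = (1, 0) by rewrite /vscale /= mul0r.
have xs : (0, b) \notin s by apply/negP => /sT; rewrite /open_triangle /= ltxx.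
rewrite /vertex_count undup_map_inj; last exact: vscale_inj.
rewrite -filter_undup count_map count_filter /= (negbTE xs) /=.
rewrite -[RHS]add1n; congr addn.
  rewrite /chain_vertex; apply/eqP; rewrite eqb1; apply/and3P; split.
  - by apply/eqP => -[] /eqP; rewrite lt_eqF.
  - by apply/eqP => -[] /eqP; rewrite eq_sym oner_eq0.
  (* All other points of the sample have a positive first coordinate, so a form that is steep enough
     in this direction is minimal at (0, b). The maximum with 1 takes care of (1, 0), as [b < 1]. *)
  apply/asboolP; have [M sM] := finite_bound s (fun q => (b - q.2) / q.1 : R).
  exists (Num.max M 1, 1) => q /=; rewrite !in_cons /dotp /= mulr0 add0r mul1r.
  case/or4P => [/eqP->|/eqP->|/eqP->|qs] // _ /=; first by rewrite mulr0 mul1r add0r.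
    by rewrite mulr1 mulr0 addr0 lt_max b1 orbT.
  have /and3P[q1 _ _] := sT _ qs; have := sM _ qs; rewrite mul1r ltr_pdivrMr //.
  rewrite ltrBlDr => /lt_le_trans; apply; rewrite lerD2r ler_pM2r // le_max lexx //.
apply: eq_in_count => p; rewrite mem_undup => ps; rewrite /= /chain_vertex.
have /and3P[p1 p2 p12] := sT _ ps.
have pA : p != (0, 1) by apply: contraTneq p1 => ->; rewrite ltxx.
have pC : p != (1, 0) by apply: contraTneq p2 => ->; rewrite ltxx.
rewrite pA pC /= -/(T' p).
have pE : p.2 = b * (p.2 / b) :> R by rewrite mulrCA divff // mulr1.
have y0 : 0 < p.2 / b :> R by rewrite divr_gt0.
have uE u : dotp u p = u.1 * p.1 + (u.2 * b) * (p.2 / b).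
  by rewrite /dotp {1}pE mulrA.
have T'E : T' p = (p.1 + p.2 / b < 1 :> R) by rewrite /T' /open_triangle /= p1 y0.
have uAE (u : R * R) : dotp u (0, 1) = u.2 by rewrite /dotp /= mulr0 mulr1 add0r.
have uCE (u : R * R) : dotp u (1, 0) = u.1 by rewrite /dotp /= mulr0 mulr1 addr0.
have uxE u : dotp u (0, b) = u.2 * b by rewrite /dotp /= mulr0 add0r.
have [T'p|T'p] := boolP (T' p); last first.
  rewrite andbF; apply/asboolPn => -[u ue].
  have uA : dotp u p < dotp u (0, 1).
    by apply: ue; [rewrite /= mem_head|apply/eqP; rewrite eq_sym].
  have uC : dotp u p < dotp u (1, 0).
    by apply: ue; [rewrite /= !in_cons eqxx orbT|apply/eqP; rewrite eq_sym].
  have ux : dotp u p < dotp u (0, b).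
    apply: ue; first by rewrite /= !in_cons eqxx !orbT.
    by move=> px; move: p1; rewrite -px ltxx.
  move: T'p; rewrite T'E -leNgt => T'p.
  have mE' : dotp u p = u.1 * p.1 + u.2 * p.2 by [].
  move: uA uC ux (uE u) mE'; rewrite uAE uCE uxE.
  move: (dotp u p) => m uA uC ux mE mE'.
  (* The weights of [p] with respect to (1, 0), (0, b) add up to at least 1, which makes [m]
     negative; those with respect to (1, 0), (0, 1) add up to less than 1, which makes [m]
     positive. *)
  have h1 : m * (p.1 + p.2 / b) < u.1 * p.1 + (u.2 * b) * (p.2 / b).
    by rewrite mulrDr ltrD // ltr_pM2r.
  have h2 : m * (p.1 + p.2) < u.1 * p.1 + u.2 * p.2 by rewrite mulrDr ltrD // ltr_pM2r.
  have h3 : m * (p.1 + p.2 / b - 1) < 0 by rewrite mulrBr mulr1 subr_lt0 [ltRHS]mE.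
  have h4 : 0 < m * (1 - (p.1 + p.2)) by rewrite mulrBr mulr1 subr_gt0 [ltRHS]mE'.
  have m0 : 0 < m by move: h4; rewrite pmulr_lgt0 // subr_gt0.
  by move: h3; rewrite pmulr_rlt0 // subr_lt0 ltNge T'p.
rewrite andbT.
have -> : [set` [:: (0, 1), (1, 0) & map (vscale b) [seq q <- s | T' q]]] =
    vscale b @` [set` [:: (0, b), (1, 0) & [seq q <- s | T' q]]].
  by rewrite image_seq /= scA scC.
have -> : vscale b p != (0, 1).
  by rewrite -scA (inj_eq (vscale_inj b0)); apply: contraTneq p1 => ->; rewrite ltxx.
have -> /= : vscale b p != (1, 0) by rewrite -scC (inj_eq (vscale_inj b0)).
apply: asbool_equiv_eq.
split=> [[u ue]|/exposed_vscale -/(_ b0) [u ue]].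
  apply/exposed_vscale => //; exists u => q.
  rewrite /= !in_cons mem_filter => qs; apply: ue; rewrite /= !in_cons.
  by case/or3P: qs => [->|->|/andP[_ ->]]; rewrite !orbT.
have uC : dotp u p < u.1.
  by rewrite -uCE; apply: ue; [rewrite /= !in_cons eqxx orbT|apply/eqP; rewrite eq_sym].
have ux : dotp u p < u.2 * b.
  rewrite -uxE; apply: ue; first by rewrite /= mem_head.
  by move=> px; move: p1; rewrite -px ltxx.
have m0 : 0 < dotp u p.
  have h1 : dotp u p * (p.1 + p.2 / b) < u.1 * p.1 + (u.2 * b) * (p.2 / b).
    by rewrite mulrDr ltrD // ltr_pM2r.
  have h2 : 0 < dotp u p * (1 - (p.1 + p.2 / b)).
    by rewrite mulrBr mulr1 subr_gt0 [ltRHS]uE.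
  by move: h2; rewrite pmulr_lgt0 // subr_gt0 -T'E.
have u20 : 0 < u.2 by move: (lt_trans m0 ux); rewrite pmulr_lgt0.
exists u => q; rewrite /= !in_cons => /or4P[/eqP->|/eqP->|/eqP->|qs] qp.
- by rewrite uAE (lt_trans ux) // gtr_pMr.
- by rewrite uCE.
- by rewrite uxE.
have [T'q|] := boolP (T' q).
  by apply: ue => //; rewrite /= !in_cons mem_filter T'q qs !orbT.
have /and3P[q1 q2 q12] := sT _ qs.
rewrite /T' /open_triangle /= q1 divr_gt0 //= -leNgt => T'q.
have qE : dotp u q = u.1 * q.1 + (u.2 * b) * (q.2 / b).
  by rewrite /dotp -mulrA [b * _]mulrC divfK.
rewrite qE; apply: le_lt_trans (_ : dotp u p * (q.1 + q.2 / b) < _).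
  by rewrite ler_peMr // ltW.
by rewrite mulrDr ltrD // ltr_pM2r // divr_gt0.
Qed.

(* The line from (0, 1) through [x] meets the horizontal axis in ([abscissa x], 0). *)
Definition abscissa (R : realType) (x : plane R) : R := x.1 / (1 - x.2).

Lemma abscissa_itv (R : realType) (x : plane R) : open_triangle x -> 0 < abscissa x < 1.
Proof.
move=> /and3P[x1 x2 x12]; have x2' : 0 < 1 - x.2 :> R by rewrite subr_gt0; lra.
by rewrite divr_gt0 //= ltr_pdivrMr // mul1r; lra.
Qed.

(* The points of the open triangle (0, 1), ([abscissa x], 0), (1, 0). *)
Definition right_of (R : realType) (x q : plane R) : bool :=
  open_triangle (shear (abscissa x) q).

(* The points of the open triangle [x], ([abscissa x], 0), (1, 0). *)
Definition below_chord (R : realType) (x q : plane R) : bool :=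
  open_triangle (vscale x.2 (shear (abscissa x) q)).

Definition first_vertex (R : realType) (x : plane R) (s : seq (plane R)) : bool :=
  open_triangle x && all (right_of x) s.

Lemma below_chord_right_of (R : realType) (x q : plane R) :
  open_triangle x -> below_chord x q -> right_of x q.
Proof.
move=> /and3P[x1 x2 x12] /and3P[/= q1 q2 q12]; apply/and3P.
have {}q2 : 0 < q.2 :> R by move: q2; rewrite pmulr_lgt0 ?invr_gt0.
split => //=; apply: le_lt_trans q12; rewrite lerD2l ler_peMr ?ltW // invf_gt1 //=; lra.
Qed.

(* Sending (abscissa x, 0) to the origin moves the first vertex [x] to (0, x.2). *)
Lemma vertex_count_first (R : realType) (x : plane R) (s : seq (plane R)) :
  first_vertex x s ->
  vertex_count (x :: s) = (vertex_count
    [seq vscale x.2 (shear (abscissa x) q) | q <- s & below_chord x q]).+1.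
Proof.
move=> /andP[Tx sT]; have /and3P[x1 x2 x12] := Tx; have /andP[c0 c1] := abscissa_itv Tx.
have x2' : 0 < 1 - x.2 :> R by lra.
have shx : shear (abscissa x) x = (0, x.2).
  by rewrite /shear /abscissa; congr pair; field; rewrite !gt_eqF //=; lra.
rewrite -(@vertex_count_shear _ (abscissa x)) //= shx vertex_count_vscale.
- congr (vertex_count _).+1; rewrite filter_map -map_comp; congr map.
- by apply/andP; split => //; lra.
- by rewrite all_map.
Qed.

(** This makes the first vertex unique: of two candidates each would have the strictly smaller
    abscissa. *)
Lemma abscissa_right_of (R : realType) (x q : plane R) :
  open_triangle x -> right_of x q -> abscissa x < abscissa q.
Proof.
move=> Tx; have /andP[_ c1] := abscissa_itv Tx; have c1' : 0 < 1 - abscissa x by lra.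
move=> /and3P[/= q1 q2 q12].
have q2' : 0 < 1 - q.2 :> R by lra.
move: q1; rewrite pmulr_lgt0 ?invr_gt0 // [abscissa q]/abscissa ltr_pdivlMr //; lra.
Qed.

(** * Iterated integrals of functions of finite sequences *)

Definition measurable_seq d (Z : measurableType d) d' (E : measurableType d') (n : nat)
    (F : Z -> seq E) : Prop :=
  (forall z, size (F z) = n) /\
  forall i, measurable_fun [set: Z] (fun z => nth point (F z) i).

(* There is no sigma-algebra on [seq E]; joint measurability in a parameter and in the
   entries of a sequence is tested against measurable families of parameters and of
   sequences of fixed length. *)
Definition seq_measurable d (Z : measurableType d) d' (E : measurableType d')
    d'' (V : measurableType d'') (H : Z -> seq E -> V) : Prop :=
  forall d1 (Y : measurableType d1) (f : Y -> Z) (n : nat) (F : Y -> seq E),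
    measurable_fun [set: Y] f -> measurable_seq n F ->
    measurable_fun [set: Y] (fun y => H (f y) (F y)).

Section MeasurableSeq.
Context d (Z : measurableType d) d' (E : measurableType d').

Lemma measurable_seq_cons n (e : Z -> E) (F : Z -> seq E) :
  measurable_fun [set: Z] e -> measurable_seq n F ->
  measurable_seq n.+1 (fun z => e z :: F z).
Proof.
move=> me [sF mF]; split=> [z|[|i]] /=; [by rewrite sF|exact: me|exact: mF].
Qed.

Lemma measurable_seq_nil : measurable_seq 0 (fun _ : Z => [::] : seq E).
Proof. by split=> // i; under eq_fun do rewrite nth_nil; exact: measurable_cst. Qed.

Lemma measurable_seq_cat n m (F G : Z -> seq E) :
  measurable_seq n F -> measurable_seq m G ->
  measurable_seq (n + m) (fun z => F z ++ G z).
Proof.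
move=> [sF mF] [sG mG]; split=> [z|i]; first by rewrite size_cat sF sG.
under eq_fun do rewrite nth_cat sF; by case: ltnP => _; [exact: mF|exact: mG].
Qed.

Lemma measurable_seq_take n i (F : Z -> seq E) :
  measurable_seq n F -> measurable_seq (minn i n) (fun z => take i (F z)).
Proof.
move=> [sF mF]; split=> [z|j]; first by rewrite size_take_min sF.
have [ji|ij] := ltnP j i; first by under eq_fun do rewrite nth_take //; exact: mF.
under eq_fun do rewrite nth_default ?size_take_min ?geq_min ?ij //.
exact: measurable_cst.
Qed.

Lemma measurable_seq_drop n i (F : Z -> seq E) :
  measurable_seq n F -> measurable_seq (n - i) (fun z => drop i (F z)).
Proof.
move=> [sF mF]; split=> [z|j]; first by rewrite size_drop sF.
by under eq_fun do rewrite nth_drop; exact: mF.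
Qed.

Lemma measurable_seq_tuple n : measurable_seq n (fun t : n.-tuple E => val t).
Proof.
split=> [t|i]; first by rewrite size_tuple.
have [ni|ni] := ltnP i n; last first.
  under eq_fun do rewrite nth_default ?size_tuple //; exact: measurable_cst.
have := @measurable_tnth _ E _ (Ordinal ni); congr (measurable_fun _ _).
by apply/funext => t; rewrite (tnth_nth point).
Qed.

Lemma seq_measurable_tuple d'' (V : measurableType d'') (h : seq E -> V) n :
  seq_measurable (fun _ : unit => h) -> measurable_fun [set: n.-tuple E] (fun t => h (val t)).
Proof.
move=> mh; apply: (mh _ _ (fun=> tt) n (fun t : n.-tuple E => val t)); [exact: measurable_cst|exact: measurable_seq_tuple].
Qed.

End MeasurableSeq.

Section IteratedIntegral.
Local Open Scope ereal_scope.
Context d (E : measurableType d) (R : realType) (mu : probability E R).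

(** The expectation of [h] at [n] independent points of law [mu]. As [h] accepts lists of every
    length, the same function can be integrated again over fewer points. *)
Fixpoint iterint (n : nat) (h : seq E -> \bar R) : \bar R :=
  if n is m.+1 then \int[mu]_x iterint m (fun s => h (x :: s)) else h [::].

Arguments iterint : simpl never.

Lemma iterintS n h : iterint n.+1 h = \int[mu]_x iterint n (fun s => h (x :: s)).
Proof. by []. Qed.

Lemma iterint_ge0 n h : (forall s, 0 <= h s) -> 0 <= iterint n h.
Proof. by elim: n h => [|n IHn] h h0; [exact: h0|rewrite iterintS]; apply: integral_ge0 => x _; apply: IHn. Qed.

Lemma eq_iterint n h h' : (forall s, size s = n -> h s = h' s) -> iterint n h = iterint n h'.
Proof.
elim: n h h' => [|n IHn] h h' hh'; first exact: hh'.
by apply: eq_integral => x _; apply: IHn => s sn; apply: hh'; rewrite /= sn.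
Qed.

Lemma seq_measurable_cons d' (Z : measurableType d') d'' (V : measurableType d'')
    (H : Z -> seq E -> V) :
  seq_measurable H -> seq_measurable (fun zx s => H zx.1 (zx.2 :: s)).
Proof.
move=> mH d1 Y f n F mf mF.
apply: (mH _ Y (fst \o f) n.+1 (fun y => (f y).2 :: F y)).
  exact: (measurableT_comp measurable_fst mf).
exact: (measurable_seq_cons (measurableT_comp measurable_snd mf) mF).
Qed.

(** The parameter space is arbitrary so that the induction can move the head of the list into the
    parameter; Tonelli then integrates it out. *)
Lemma measurable_iterint d' (Z : measurableType d') n (H : Z -> seq E -> \bar R) :
  (forall z s, 0 <= H z s) -> seq_measurable H ->
  measurable_fun [set: Z] (fun z => iterint n (H z)).
Proof.
elim: n => [|n IHn] in d' Z H *; move=> H0 mH.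
  exact: (mH _ _ id 0%N (fun=> [::]) (@measurable_id _ _ _) (@measurable_seq_nil _ _ _ _)).
apply: (@measurable_fun_fubini_tonelli_F _ _ _ _ R mu
  (fun zx => iterint n (fun s => H zx.1 (zx.2 :: s)))).
- by apply: IHn => //; apply: seq_measurable_cons.
- by move=> zx; apply: iterint_ge0.
Qed.

Definition cons_tuple_pair n (xt : E * n.-tuple E) : n.+1.-tuple E := [tuple of xt.1 :: xt.2].

Lemma measurable_cons_tuple_pair n : measurable_fun [set: E * n.-tuple E] (@cons_tuple_pair n).
Proof. exact: measurable_cons. Qed.

HB.instance Definition _ n :=
  isMeasurableFun.Build _ _ _ _ (@cons_tuple_pair n) (@measurable_cons_tuple_pair n).

(** The n-fold product law. Through it [iterint] inherits additivity and monotonicity from a single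
    integral, and can be compared with the law of a sample. *)
Fixpoint tuple_power (n : nat) : probability (n.-tuple E) R :=
  if n is m.+1 then distribution (mu \x tuple_power m)%E (@cons_tuple_pair m)
  else \d_[tuple].

Lemma integral_tuple_power n (h : seq E -> \bar R) : (forall s, 0 <= h s) ->
  seq_measurable (fun _ : unit => h) -> \int[tuple_power n]_t h t = iterint n h.
Proof.
elim: n h => [|n IHn] h h0 mh /=.
  rewrite integral_dirac ?diracT ?mul1e //.
  exact: (seq_measurable_tuple mh).
have mh' : measurable_fun [set: n.+1.-tuple E] (fun t => h t) by exact: (seq_measurable_tuple mh).
rewrite ge0_integral_distribution //.
rewrite fubini_tonelli1 //=; last exact: (measurableT_comp mh' (@measurable_cons_tuple_pair n)).
rewrite iterintS; apply: eq_integral => x _; rewrite -IHn //.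
move=> d1 Y f m F mf mF.
apply: (mh _ _ (fun=> tt) m.+1 (fun y => x :: F y)); first exact: measurable_cst.
by apply: measurable_seq_cons => //; apply: measurable_cst.
Qed.

Lemma seq_measurable_cons_cst d'' (V : measurableType d'') (h : seq E -> V) x :
  seq_measurable (fun _ : unit => h) -> seq_measurable (fun (_ : unit) s => h (x :: s)).
Proof.
move=> mh d1 Y f m F mf mF.
apply: (mh _ _ (fun=> tt) m.+1 (fun y => x :: F y)); first exact: measurable_cst.
by apply: measurable_seq_cons => //; apply: measurable_cst.
Qed.

Lemma seq_measurable_cons_fun d'' (V : measurableType d'') (h : seq E -> V) :
  seq_measurable (fun _ : unit => h) -> seq_measurable (fun x s => h (x :: s)).
Proof.
move=> mh d1 Y f m F mf mF.
apply: (mh _ _ (fun=> tt) m.+1 (fun y => f y :: F y)); first exact: measurable_cst.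
exact: measurable_seq_cons.
Qed.

(** Tonelli moves the variable of index [i] to the front, one transposition at a time. The candidate
    for the first vertex thus becomes the outermost variable. *)
Lemma iterint_insert n i (h : seq E -> \bar R) : (forall s, 0 <= h s) ->
  seq_measurable (fun _ : unit => h) -> (i <= n)%N ->
  iterint n.+1 h = \int[mu]_x iterint n (fun s => h (take i s ++ x :: drop i s)).
Proof.
move=> h0 mh; elim: i => [|i IHi] in n h h0 mh * => ni.
  by apply: eq_integral => x _; apply: eq_iterint => s _; rewrite take0 drop0.
case: n => // n in ni *.
transitivity (\int[mu]_y \int[mu]_x iterint n (fun s => h (y :: take i s ++ x :: drop i s))).
  apply: eq_integral => y _.
  exact: (IHi n (fun s => h (y :: s)) (fun s => h0 _) (seq_measurable_cons_cst y mh) ni).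
pose f (p : E * E) := iterint n (fun s => h (p.1 :: take i s ++ p.2 :: drop i s)).
have mf : measurable_fun [set: E * E] f.
  apply: (@measurable_iterint _ _ n (fun p s => h (p.1 :: take i s ++ p.2 :: drop i s))) => //.
  move=> d1 Y g m F mg mF.
  apply: (mh _ _ (fun=> tt) (minn i m + (m - i).+1).+1
    (fun y => (g y).1 :: take i (F y) ++ (g y).2 :: drop i (F y))).
    exact: measurable_cst.
  apply: (measurable_seq_cons (measurableT_comp measurable_fst mg)).
  apply: measurable_seq_cat; first exact: measurable_seq_take.
  apply: (measurable_seq_cons (measurableT_comp measurable_snd mg)).
  exact: measurable_seq_drop.
have f0 p : 0 <= f p by apply: iterint_ge0.
exact: (@fubini_tonelli _ _ _ _ R mu mu f mf f0).
Qed.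

Lemma iterintD n (h1 h2 : seq E -> \bar R) :
  (forall s, 0 <= h1 s) -> seq_measurable (fun _ : unit => h1) ->
  (forall s, 0 <= h2 s) -> seq_measurable (fun _ : unit => h2) ->
  iterint n (fun s => h1 s + h2 s) = iterint n h1 + iterint n h2.
Proof.
move=> h10 mh1 h20 mh2; rewrite -!integral_tuple_power //.
- by rewrite -ge0_integralD //; exact: seq_measurable_tuple.
- by move=> s; apply: adde_ge0.
- move=> d1 Y f m F mf mF; apply: emeasurable_funD; [exact: (mh1 _ _ f m)|exact: (mh2 _ _ f m)].
Qed.

Lemma iterint_sum n (I : finType) (h : I -> seq E -> \bar R) :
  (forall i s, 0 <= h i s) -> (forall i, seq_measurable (fun _ : unit => h i)) ->
  iterint n (fun s => \sum_i h i s) = \sum_i iterint n (h i).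
Proof.
move=> h0 mh; rewrite -integral_tuple_power.
- rewrite ge0_integral_sum //; last by move=> i; exact: seq_measurable_tuple.
  by apply: eq_bigr => i _; rewrite integral_tuple_power.
- by move=> s; apply: sume_ge0.
- by move=> d1 Y f m F mf mF; apply: emeasurable_sum => i; exact: (mh i _ _ f m).
Qed.

Lemma iterint_cst n c : iterint n (fun=> c%:E) = c%:E.
Proof.
elim: n => // n IHn; rewrite iterintS; under eq_integral do rewrite IHn.
by rewrite integral_cst // [X in _ * X](probability_setT mu) mule1.
Qed.

Lemma le_iterint n h h' : (forall s, 0 <= h s) -> seq_measurable (fun _ : unit => h) ->
  seq_measurable (fun _ : unit => h') ->
  (forall s, h s <= h' s) -> iterint n h <= iterint n h'.
Proof.
move=> h0 mh mh' hh'; rewrite -!integral_tuple_power //; last first.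
  by move=> s; apply: le_trans (hh' s).
by apply: ge0_le_integral => //; [exact: seq_measurable_tuple|exact: seq_measurable_tuple].
Qed.

(** A binomial expansion over which points are kept: a point in [B] is dropped at the cost [b], a
    point in [A] is kept, and [th] carries [mu] restricted to [A] to [k] times [mu], so that the [l]
    kept points are again independent of law [mu]. *)
Lemma iterint_filter n (A B : E -> bool) (th : E -> E) (h : seq E -> \bar R) (k b : R) :
  measurable [set` A] -> measurable [set` B] -> (forall x, A x -> ~~ B x) ->
  (0 <= k)%R -> (0 <= b)%R -> mu [set` B] = b%:E ->
  (forall f : E -> \bar R, (forall x, 0 <= f x) -> measurable_fun [set: E] f ->
    \int[mu]_(x in [set` A]) f (th x) = k%:E * \int[mu]_x f x) ->
  measurable_fun [set: E] th ->
  (forall s, 0 <= h s) -> seq_measurable (fun _ : unit => h) ->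
  iterint n (fun s => if all (fun q => A q || B q) s then h [seq th q | q <- s & A q] else 0) =
  \sum_(l < n.+1) ('C(n, l)%:R * b ^+ (n - l) * k ^+ l)%:E * iterint l h.
Proof.
move=> mA mB AB k0 b0 muB kth mth; elim: n h => [|n IHn] h h0 mh.
  by rewrite big_ord1 bin0 !expr0 !mulr1 mul1e.
pose S h' := \sum_(l < n.+1) ('C(n, l)%:R * b ^+ (n - l) * k ^+ l)%:E * iterint l h'.
have c0 l : (0 <= ('C(n, l)%:R * b ^+ (n - l) * k ^+ l))%R.
  by rewrite !mulr_ge0 ?exprn_ge0 ?ler0n.
have S0 h' : (forall s, 0 <= h' s) -> 0 <= S h'.
  by move=> h'0; apply: sume_ge0 => l _; rewrite mule_ge0 ?lee_fin ?iterint_ge0.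
pose g x := S (fun s => h (x :: s)).
have mg : measurable_fun [set: E] g.
  apply: emeasurable_sum => l; apply: measurable_funeM.
  by apply: measurable_iterint => //; apply: seq_measurable_cons_fun.
(* If the head lies in [B] it disappears; if it lies in [A] its image stays in front of the rest;
   otherwise the integrand vanishes. *)
rewrite iterintS; transitivity (\int[mu]_x ((cst (S h) \_ [set` B]) x + ((g \o th) \_ [set` A]) x)).
  apply: eq_integral => x _; rewrite !patchE !mem_setE.
  have [-> ->] : (x \in B) = B x /\ (x \in A) = A x by [].
  rewrite (_ : point = 0) //=.
  case Ax : (A x) => /=.
    rewrite (negbTE (AB _ Ax)) add0e /g /S -(IHn (fun s => h (th x :: s))) //.
    exact: seq_measurable_cons_cst.
  case Bx : (B x) => /=; first by rewrite adde0 IHn.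
  by rewrite adde0; exact: (iterint_cst n 0).
rewrite ge0_integralD //=; last 4 first.
- by move=> x _; rewrite patchE; case: ifP => // _; apply: S0.
- by apply/(measurable_restrictT _ _).1 => //; apply: measurable_cst.
- by move=> x _; rewrite patchE; case: ifP => // _; apply: S0.
- apply/(measurable_restrictT _ _).1 => //.
  by apply: measurable_funTS; apply: measurableT_comp.
rewrite -!integral_mkcond integral_cst // [X in _ * X + _]muB.
have -> : \int[mu]_(x in [set` A]) (g \o th) x = k%:E * \int[mu]_x g x.
  by apply: kth => // x; apply: S0.
rewrite ge0_integral_sum //; last 2 first.
- move=> l; apply: measurable_funeM.
  by apply: measurable_iterint => //; apply: seq_measurable_cons_fun.
- by move=> l x _; rewrite mule_ge0 ?lee_fin ?iterint_ge0.
have -> : \sum_(l < n.+1) \int[mu]_x (('C(n, l)%:R * b ^+ (n - l) * k ^+ l)%:E *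
      iterint l (fun s => h (x :: s))) =
    \sum_(l < n.+1) ('C(n, l)%:R * b ^+ (n - l) * k ^+ l)%:E * iterint l.+1 h.
  apply: eq_bigr => l _; rewrite ge0_integralZl ?lee_fin //.
  - by apply: measurable_iterint => //; apply: seq_measurable_cons_fun.
  - by move=> x _; apply: iterint_ge0.
rewrite muleC /S !ge0_sume_distrr; try by move=> l _; rewrite mule_ge0 ?lee_fin ?iterint_ge0.
rewrite [RHS]big_ord_recl [X in X + _]big_ord_recl /= -addeA; congr (_ + _).
  by rewrite muleA -EFinM !bin0 !subn0 exprS; congr (_%:E * _); ring.
(* Pascal's rule separates the lists whose head was dropped from those whose head was kept. *)
have -> : \sum_(l < n.+1) ('C(n.+1, bump 0 l)%:R * b ^+ (n.+1 - bump 0 l) * k ^+ bump 0 l)%:E *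
    iterint (bump 0 l) h = \sum_(l < n.+1) (('C(n, l.+1)%:R * b ^+ (n - l) * k ^+ l.+1)%:E *
      iterint l.+1 h + k%:E * (('C(n, l)%:R * b ^+ (n - l) * k ^+ l)%:E * iterint l.+1 h)).
  apply: eq_bigr => l _; rewrite /bump /= add1n muleA -EFinM -ge0_muleDl ?lee_fin //; last 2 first.
  - by rewrite !mulr_ge0 ?exprn_ge0 ?ler0n.
  - by rewrite mulr_ge0.
  by rewrite -EFinD binS subSS natrD exprS; congr (_%:E * _); ring.
rewrite big_split /=; congr (_ + _).
rewrite big_ord_recr /= bin_small // !mul0r mul0e adde0.
apply: eq_bigr => l _; rewrite muleA -EFinM /bump /= add1n; congr (_%:E * _).
have -> : (n - l = (n - l.+1).+1)%N by rewrite subnSK.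
by rewrite [in RHS]exprS; ring.
Qed.

End IteratedIntegral.

(** * The law of an independent sample *)

Section IndependentSample.
Local Open Scope ereal_scope.
Context d (E : measurableType d) (R : realType).

Definition rectangle n (A : 'I_n -> set E) : set (n.-tuple E) :=
  \bigcap_i [set t | A i (tnth t i)].

Lemma measurable_rectangle n (A : 'I_n -> set E) :
  (forall i, measurable (A i)) -> measurable (rectangle A).
Proof.
move=> mA; apply: fin_bigcap_measurable => // i _.
by have := @measurable_tnth _ E n i measurableT _ (mA i); rewrite setTI.
Qed.

Lemma tuple_power_rectangle (mu : probability E R) n (A : 'I_n -> set E) :
  (forall i, measurable (A i)) -> tuple_power mu n (rectangle A) = \prod_i mu (A i).
Proof.
elim: n A => [|n IHn] A mA /=.
  by rewrite diracE mem_set ?big_ord0 // => -[].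
rewrite big_ord_recl -IHn //= /distribution /pushforward /=.
have -> : cons_tuple_pair (n := n) @^-1` rectangle A =
    A ord0 `*` rectangle (fun i => A (lift ord0 i)).
  apply/seteqP; split=> -[x t] /=.
    move=> xtA; split=> [|i _ /=]; first exact: (xtA ord0).
    by have := xtA (lift ord0 i) I; rewrite /= tnthS.
  move=> [xA tA] i _ /=; case: (unliftP ord0 i) => [j ->|->]; last exact: xA.
  by rewrite /= tnthS; apply: tA.
by rewrite product_measure1E //; exact: measurable_rectangle.
Qed.

Lemma measurable_tuple_rectangles n :
  measurable = <<s [set B | exists2 A : 'I_n -> set E, forall i, measurable (A i) & B = rectangle A] >>
  :> set (set (n.-tuple E)).
Proof.
apply/seteqP; split.
  apply: smallest_sub; first exact: smallest_sigma_algebra.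
  move=> B; rewrite -bigcup_seq /= => -[i _ [A mA <-]].
  apply: sub_sigma_algebra; exists (fun j => if j == i then A else setT).
    by move=> j; case: ifP.
  apply/seteqP; split=> t /=; first by move=> [_ tA] j _ /=; case: eqP => [->|].
  by move=> tA; split => //; have := tA i I; rewrite /= eqxx.
apply: smallest_sub; first exact: sigma_algebra_measurable.
by move=> _ [A mA ->]; exact: measurable_rectangle.
Qed.

Context d' (Omega : measurableType d') (P : probability Omega R).

Lemma probability_independent_sample (mu : probability E R) n (X : 'I_n -> {RV P >-> E})
    (Q : seq E -> bool) :
  mutually_independent X ->
  (forall i A, measurable A -> distribution P (X i) A = mu A) ->
  seq_measurable (fun _ : unit => Q) ->
  P [set w | Q [seq X i w | i : 'I_n]] = iterint mu n (fun s => (Q s)%:R%:E).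
Proof.
move=> indX lawX mQ.
pose T w := [tuple X i w | i < n].
have mT : measurable_fun [set: Omega] T.
  apply/measurable_fun_tnthP => i.
  rewrite (_ : _ \o _ = X i) //; apply/funext => w; rewrite /= tnth_mktuple //.
pose T' : {RV P >-> n.-tuple E} := HB.pack T (isMeasurableFun.Build _ _ _ _ T mT).
have lawT B : measurable B -> distribution P T' B = tuple_power mu n B.
  (* Both laws agree on rectangles, a class that is stable under intersection and generates the
     sigma-algebra. *)
  move=> mB; apply: (measure_unique [set B | exists2 A : 'I_n -> set E,
    forall i, measurable (A i) & B = rectangle A] (fun=> setT)) => //.
  - exact: measurable_tuple_rectangles.
  - move=> _ _ [A mA ->] [A' mA' ->]; exists (fun i => A i `&` A' i).
      by move=> i; apply: measurableI.
    by rewrite /rectangle -bigcapI.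
  - move=> _; exists (fun=> setT) => //.
    by apply/seteqP; split.
  - by rewrite bigcup_const.
  - move=> _ [A mA ->]; transitivity (\prod_i mu (A i)); last exact/esym/tuple_power_rectangle.
    have := indX [set: 'I_n]%SET A mA.
    have -> : \bigcap_(i in [set` [set: 'I_n]]%SET) (X i @^-1` A i) = T' @^-1` rectangle A.
      apply/seteqP; split=> w /= wA i; first by move=> _ /=; rewrite tnth_mktuple; apply: wA; rewrite /= inE.
      by move=> _; have := wA i I; rewrite /= tnth_mktuple.
    move=> indXA; transitivity (\prod_(i in [set: 'I_n]%SET) P (X i @^-1` A i)); first exact: indXA.
    apply: eq_big => i; first by rewrite inE.
    by move=> _; rewrite -(lawX i).
  - by move=> k; rewrite (le_lt_trans (probability_le1 _ _)) ?ltry.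
have mQn : measurable [set t : n.-tuple E | Q (val t)].
  rewrite -[X in measurable X](setTI ((fun t : n.-tuple E => Q (val t)) @^-1` [set true])).
  exact: (seq_measurable_tuple mQ).
rewrite -integral_tuple_power; last 2 first.
- by move=> s; rewrite lee_fin.
- move=> d1 Y f m F mf mF; apply/measurable_EFinP.
  rewrite (_ : (fun y => _) = (fun y => if Q (F y) then 1%R else 0%R)); last first.
    by apply/funext => y; case: (Q _).
  apply: measurable_fun_ifT => //; exact: (mQ _ _ f m).
transitivity (tuple_power mu n [set t : n.-tuple E | Q (val t)]).
  by rewrite -lawT // /distribution /pushforward; congr (P _); apply/seteqP; split.
rewrite -[LHS]mul1e -(integral_cst _ _ 1) //.
rewrite integral_mkcond; apply: eq_integral => t _; rewrite patchE /=.
by case: ifPn => [/set_mem /= -> //|/negP]; rewrite inE /= => /negP/negbTE ->.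
Qed.

End IndependentSample.

(** * Measurability of the number of vertices *)

(** Finitely many strict inequalities survive a small change of [u], and the rationals are dense. *)
Lemma rational_tilt (R : realType) (T : eqType) (s : seq T) (f g : T -> R) (u : R) :
  {in s, forall q, 0 < u * f q + g q} ->
  exists r : rat, {in s, forall q, 0 < ratr r * f q + g q}.
Proof.
move=> us.
have [e e0 es] : exists2 e, 0 < e &
    {in s, forall q, forall r, `|r - u| < e -> 0 < r * f q + g q}.
  elim: s us => [_|q s IHs us]; first by exists 1.
  have [|e e0 es] := IHs; first by move=> p ps; apply: us; rewrite in_cons ps orbT.
  have uq : 0 < u * f q + g q by apply: us; rewrite mem_head.
  have f0 : 0 < `|f q| + 1 by rewrite ltr_wpDl.
  (* The [+ 1] keeps the denominator positive when [f q = 0]. *)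
  exists (Num.min e ((u * f q + g q) / (`|f q| + 1))).
    by rewrite lt_min e0 divr_gt0.
  move=> p; rewrite in_cons => /orP[/eqP->|ps] r; rewrite lt_min => /andP[re rq].
    move: rq; rewrite ltr_pdivlMr // mulrDr mulr1 => rq.
    have : `|(r - u) * f q| < u * f q + g q.
      by rewrite normrM (le_lt_trans _ rq) // lerDl.
    by rewrite ltr_norml => /andP[+ _]; lra.
  exact: es.
have [|r] := @rat_in_itvoo R (u - e) (u + e); first by rewrite ltrD2l gtrN.
rewrite in_itv /= => /andP[r1 r2]; exists r => q qs.
by apply: es => //; rewrite ltr_norml; lra.
Qed.

(** The coefficients become rational one at a time: [r1] is frozen inside the constant term while
    the second coefficient is tilted. *)
Lemma exposed_rational (R : realType) (s : seq (plane R)) (v : plane R) :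
  exposed [set` s] v <-> exists r1 r2 : rat,
    all (fun q => (q == v) || (dotp (ratr r1, ratr r2) v < dotp (ratr r1, ratr r2) q)) s.
Proof.
split=> [[u us]|[r1 [r2 /allP rs]]]; last first.
  by exists (ratr r1, ratr r2) => q /= /rs /orP[/eqP->|].
have [|r1 r1s] := @rational_tilt R _ [seq q <- s | q != v] (fun q => q.1 - v.1)
    (fun q => u.2 * (q.2 - v.2)) u.1.
  move=> q; rewrite mem_filter => /andP[/eqP qv qs].
  by have := us _ qs qv; rewrite /dotp -subr_gt0; congr (0 < _); ring.
have [|r2 r2s] := @rational_tilt R _ [seq q <- s | q != v] (fun q => q.2 - v.2)
    (fun q => ratr r1 * (q.1 - v.1)) u.2.
  by move=> q /r1s; rewrite addrC.
exists r1, r2; apply/allP => q qs; have [->//|qv] /= := eqVneq q v.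
have := r2s q; rewrite mem_filter qv qs => /(_ isT).
rewrite -(subr_gt0 (dotp _ v)) /dotp /=; congr (0 < _); ring.
Qed.

Section MeasurableVertexCount.
Context d (Y : measurableType d) d' (E : measurableType d').

Lemma measurable_seq_head n (F : Y -> seq E) :
  measurable_seq n.+1 F -> measurable_fun [set: Y] (fun y => head point (F y)).
Proof. by move=> [_ mF]; under eq_fun do rewrite -nth0; exact: mF. Qed.

Lemma measurable_seq_behead n (F : Y -> seq E) :
  measurable_seq n.+1 F -> measurable_seq n (fun y => behead (F y)).
Proof.
move=> [sF mF]; split=> [y|i]; first by rewrite size_behead sF.
by under eq_fun do rewrite nth_behead; exact: mF.
Qed.

Lemma measurable_all (b : Y -> E -> bool) n (F : Y -> seq E) :
  (forall e : Y -> E, measurable_fun [set: Y] e -> measurable_fun [set: Y] (fun y => b y (e y))) ->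
  measurable_seq n F -> measurable_fun [set: Y] (fun y => all (b y) (F y)).
Proof.
move=> mb; elim: n => [|n IHn] in F * => mF.
  rewrite (_ : (fun y => _) = cst true); first exact: measurable_cst.
  by apply/funext => y; have /size0nil -> := mF.1 y.
rewrite (_ : (fun y => _) = fun y => b y (head point (F y)) && all (b y) (behead (F y))).
  apply: measurable_and; first exact/mb/(measurable_seq_head mF).
  exact/IHn/measurable_seq_behead.
by apply/funext => y; have := mF.1 y; case: (F y).
Qed.

End MeasurableVertexCount.

Section MeasurablePlane.
Context (R : realType) d (Y : measurableType d).
Implicit Types e : Y -> plane R.

Lemma measurable_plane1 e : measurable_fun [set: Y] e -> measurable_fun [set: Y] (fun y => (e y).1 : R).
Proof. by move=> me; exact: (measurableT_comp measurable_fst me). Qed.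

Lemma measurable_plane2 e : measurable_fun [set: Y] e -> measurable_fun [set: Y] (fun y => (e y).2 : R).
Proof. by move=> me; exact: (measurableT_comp measurable_snd me). Qed.

Lemma measurable_plane_eq e e' : measurable_fun [set: Y] e -> measurable_fun [set: Y] e' ->
  measurable_fun [set: Y] (fun y => e y == e' y).
Proof.
move=> me me'.
by apply: measurable_and; apply: measurable_fun_eqr;
  [exact: measurable_plane1|exact: measurable_plane1|exact: measurable_plane2|exact: measurable_plane2].
Qed.

Lemma measurable_dotp u e : measurable_fun [set: Y] e -> measurable_fun [set: Y] (fun y => dotp u (e y)).
Proof.
move=> me; apply: measurable_funD; apply: measurable_funM => //.
  exact: measurable_plane1.
exact: measurable_plane2.
Qed.

Lemma measurable_chain_vertex n (F : Y -> seq (plane R)) e :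
  measurable_seq n F -> measurable_fun [set: Y] e ->
  measurable_fun [set: Y] (fun y => chain_vertex (F y) (e y)).
Proof.
move=> mF me; apply: measurable_and.
  by apply/measurable_neg/measurable_plane_eq.
apply: measurable_and.
  by apply/measurable_neg/measurable_plane_eq.
apply: (measurable_fun_bool true); rewrite setTI.
rewrite (_ : _ @^-1` _ = \bigcup_(r1 : rat) \bigcup_(r2 : rat)
   (fun y => all (fun q => (q == e y) ||
     (dotp (ratr r1, ratr r2) (e y) < dotp (ratr r1, ratr r2) q)) [:: (0, 1), (1, 0) & F y])
   @^-1` [set true]); last first.
  apply/seteqP; split=> y /=.
    by move=> /asboolP/exposed_rational[r1 [r2 r12]]; exists r1 => //; exists r2.
  by move=> [r1 _ [r2 _ r12]]; apply/asboolP/exposed_rational; exists r1, r2.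
apply: bigcupT_measurable_rat => r1; apply: bigcupT_measurable_rat => r2.
rewrite -[X in measurable X]setTI.
suff : measurable_fun [set: Y] (fun y => all (fun q => (q == e y) ||
     (dotp (ratr r1, ratr r2) (e y) < dotp (ratr r1, ratr r2) q)) [:: (0, 1), (1, 0) & F y]).
  by apply.
apply: (@measurable_all _ _ _ _ _ n.+2 (fun y => [:: (0, 1), (1, 0) & F y])).
  move=> e' me'; apply: measurable_or; first exact: measurable_plane_eq.
  by apply: measurable_fun_ltr; exact: measurable_dotp.
by do 2!apply: measurable_seq_cons => //.
Qed.

Lemma measurable_count_undup (p : Y -> plane R -> bool) n (F : Y -> seq (plane R)) :
  (forall e, measurable_fun [set: Y] e -> measurable_fun [set: Y] (fun y => p y (e y))) ->
  measurable_seq n F -> measurable_fun [set: Y] (fun y => count (p y) (undup (F y))).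
Proof.
move=> mp; elim: n => [|n IHn] in F * => mF.
  rewrite (_ : (fun y => _) = cst 0%N); first exact: measurable_cst.
  by apply/funext => y; have /size0nil -> := mF.1 y.
pose e y := head point (F y); have me : measurable_fun [set: Y] e := measurable_seq_head mF.
have mB := measurable_seq_behead mF.
(* [undup] drops an entry that recurs later, so the head counts only if it differs from the whole
   tail. *)
rewrite (_ : (fun y => _) = fun y => ((if all (fun q => q != e y) (behead (F y)) then
    if p y (e y) then 1 else 0 else 0) + count (p y) (undup (behead (F y))))%N).
  apply: measurable_fun_addn; last exact: IHn.
  apply: measurable_fun_ifT => //; last by apply: measurable_fun_ifT => //; exact: mp.
  apply: measurable_all mB => e' me'.
  by apply/measurable_neg/measurable_plane_eq.
apply/funext => y; rewrite /e; have := mF.1 y; case: (F y) => // x s _ /=.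
have -> : all (fun q => q != x) s = (x \notin s).
  by rewrite -has_pred1 -all_predC.
by case: (x \in s) => //=; case: (p y x).
Qed.

End MeasurablePlane.

Lemma seq_measurable_vertex_count (R : realType) (k : nat) :
  seq_measurable (fun (_ : unit) (s : seq (plane R)) => vertex_count s == k).
Proof.
move=> d Y f n F _ mF.
apply: measurable_fun_eqn => //.
apply: (measurable_count_undup _ mF) => e me.
exact: measurable_chain_vertex mF me.
Qed.

(** * Areas and affine maps *)

Lemma measurable_affine (R : realType) (a b : R) :
  measurable_fun [set: measurableTypeR R] ((fun x => a * x + b) : measurableTypeR R -> measurableTypeR R).
Proof. by apply: measurable_funD => //; exact: measurable_funM. Qed.

(** The right-hand side is a measure in [A] with the value [q - p] on the interval from [p] to [q],
    so it is Lebesgue measure by uniqueness. *)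
Lemma lebesgue_measure_affine (R : realType) (a b : R) (A : set (measurableTypeR R)) :
  0 < a -> measurable A ->
  lebesgue_measure A = (a%:E * lebesgue_measure ((fun x => a * x + b)%R @^-1` A))%E.
Proof.
move=> a0 mA.
pose phi : {mfun measurableTypeR R >-> measurableTypeR R} :=
  HB.pack (fun x : measurableTypeR R => a * x + b : measurableTypeR R)
    (isMeasurableFun.Build _ _ _ _ _ (measurable_affine a b)).
have -> : (a%:E * lebesgue_measure ((fun x => a * x + b)%R @^-1` A))%E =
   mscale (NngNum (ltW a0)) (pushforward lebesgue_measure phi) A by [].
apply: lebesgue_measure_unique => // _ [[p q]] _ <- /=.
rewrite /mscale /= /pushforward.
have -> : (fun x => a * x + b) @^-1` `]p, q]%classic = `](p - b) / a, (q - b) / a]%classic.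
  apply/seteqP; split=> x /=; rewrite !in_itv /= ltr_pdivrMr // ler_pdivlMr //.
    by move=> /andP[h1 h2]; apply/andP; split; lra.
  by move=> /andP[h1 h2]; apply/andP; split; lra.
rewrite !lebesgue_measure_itv /= !lte_fin ltr_pM2r ?invr_gt0 // ltrD2r.
case: ifP => _; last by rewrite mule0.
by rewrite -!EFinD -EFinM; congr (_%:E); field; rewrite gt_eqF.
Qed.

Local Open Scope ereal_scope.

Lemma ge0_integral_affine (R : realType) (a b : R) (f : R -> \bar R) : (0 < a)%R ->
  measurable_fun [set: measurableTypeR R] f -> (forall x, 0 <= f x) ->
  \int[@lebesgue_measure R]_x f (a * x + b)%R = (a^-1)%:E * \int[@lebesgue_measure R]_x f x.
Proof.
move=> a0 mf f0.
pose phi : {mfun measurableTypeR R >-> measurableTypeR R} :=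
  HB.pack (fun x : measurableTypeR R => (a * x + b)%R : measurableTypeR R)
    (isMeasurableFun.Build _ _ _ _ _ (measurable_affine a b)).
rewrite [in RHS](@eq_measure_integral _ _ _ _
  (mscale (NngNum (ltW a0)) (pushforward (@lebesgue_measure R) phi))).
  rewrite ge0_integral_mscale // ge0_integral_pushforward //.
  by rewrite muleA -EFinM /= mulVf ?gt_eqF // mul1e preimage_setT.
by move=> A mA _; exact: lebesgue_measure_affine.
Qed.

Section PlaneIntegral.
Context (R : realType).
Notation mu1 := (@lebesgue_measure R).
Implicit Types f : plane R -> \bar R.

Lemma measurable_shear (c : R) : measurable_fun [set: plane R] (shear c).
Proof.
have m1 : measurable_fun [set: plane R] (fun p => (p.1 - c + c * p.2) / (1 - c) : R)%R.
  have m1 := measurable_plane1 (@measurable_id _ (plane R) setT).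
  have m2 := measurable_plane2 (@measurable_id _ (plane R) setT).
  apply: measurable_funM => //; apply: measurable_funD; first exact: measurable_funB.
  exact: measurable_funM.
by apply/measurable_fun_pairP; split; [exact: m1|exact: measurable_snd].
Qed.

Lemma measurable_vscale (b : R) : measurable_fun [set: plane R] (vscale b).
Proof.
have m2 : measurable_fun [set: plane R] (fun p => p.2 / b : R)%R.
  have m2 := measurable_plane2 (@measurable_id _ (plane R) setT).
  exact: measurable_funM.
by apply/measurable_fun_pairP; split; [exact: measurable_fst|exact: m2].
Qed.

Lemma measurable_open_triangle : measurable_fun [set: plane R] (@open_triangle R).
Proof.
have m1 := measurable_plane1 (@measurable_id _ (plane R) setT).
have m2 := measurable_plane2 (@measurable_id _ (plane R) setT).
by apply: measurable_and; [|apply: measurable_and]; apply: measurable_fun_ltr => //;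
  exact: measurable_funD.
Qed.

(** On every horizontal line the shear is an affine map of slope [(1 - c)^-1], so Tonelli reduces
    the claim to one variable. *)
Lemma ge0_integral_shear (c : R) f : (c < 1)%R ->
  measurable_fun [set: plane R] f -> (forall q, 0 <= f q) ->
  \int[mu1 \x mu1]_q f (shear c q) = (1 - c)%:E * \int[mu1 \x mu1]_q f q.
Proof.
move=> c1 mf f0; have c1' : (0 < 1 - c)%R by rewrite subr_gt0.
rewrite !fubini_tonelli2 //; last by apply: measurableT_comp mf (measurable_shear c).
rewrite -ge0_integralZl ?lee_fin ?ltW //; last 2 first.
- exact: measurable_fun_fubini_tonelli_G.
- by move=> y _; apply: integral_ge0.
apply: eq_integral => y _; rewrite /fubini_G.
transitivity (\int[mu1]_x f ((1 - c)^-1 * x + (c * y - c) / (1 - c), y)%R).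
  by apply: eq_integral => x _; congr (f (_, _)); rewrite /=; ring.
rewrite (@ge0_integral_affine _ _ _ (fun x => f (x, y))) ?invr_gt0 ?invrK //.
exact: (measurable_fun_pair1 y mf).
Qed.

Lemma ge0_integral_vscale (b : R) f : (0 < b)%R ->
  measurable_fun [set: plane R] f -> (forall q, 0 <= f q) ->
  \int[mu1 \x mu1]_q f (vscale b q) = b%:E * \int[mu1 \x mu1]_q f q.
Proof.
move=> b0 mf f0.
rewrite !fubini_tonelli1 //; last by apply: measurableT_comp mf (measurable_vscale b).
rewrite -ge0_integralZl ?lee_fin ?ltW //; last 2 first.
- exact: measurable_fun_fubini_tonelli_F.
- by move=> y _; apply: integral_ge0.
apply: eq_integral => x _; rewrite /fubini_F.
transitivity (\int[mu1]_y f (x, b^-1 * y + 0)%R).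
  by apply: eq_integral => y _; rewrite /vscale /= addr0 mulrC.
rewrite (@ge0_integral_affine _ _ _ (fun y => f (x, y))) ?invr_gt0 ?invrK //.
exact: (measurable_fun_pair2 x mf).
Qed.

End PlaneIntegral.

Section TriangleArea.
Context (R : realType).
Notation mu1 := (@lebesgue_measure R).

Lemma integral_monomial_oo (a b : nat) :
  \int[mu1]_(x in `]0%R, 1%R[) (x ^+ a * (1 - x) ^+ b)%:E =
  ((a`! * b`!)%:R / (a + b).+1`!%:R)%:E.
Proof.
rewrite -beta_fun_fact EFin_beta_fun /=.
rewrite -(@integral_itv_bndoo _ _ _ _ true false); last first.
  apply/measurable_EFinP/measurable_funTS.
  by apply: measurable_funM; apply: measurable_funX => //; exact: measurable_funB.
rewrite integral_mkcond; apply: eq_integral => x _.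
by rewrite /patch; case: ifP.
Qed.

Lemma triangleE : triangle R = [set p | [/\ 0 <= p.1, 0 <= p.2 & p.1 + p.2 <= 1]%R].
Proof.
apply/seteqP; split=> [p|[x y] /= [x0 y0 xy1]].
  apply; split.
    apply/convex_setE => -[a1 a2] [b1 b2] l /= [? ? ?] [? ? ?] /andP[l0 l1].
    by split; nra.
  by move=> q /=; case=> [[]|] ->; rewrite /= ?lexx ?ler01 ?addr0 ?add0r ?lexx //; split.
have cT := @convex_hull_convex R [set (0, 0); (0, 1); (1, 0)]%R.
have T0 : triangle R (0, 0)%R by apply: convex_hull_sub; left; left.
have TA : triangle R (0, 1)%R by apply: convex_hull_sub; left; right.
have TC : triangle R (1, 0)%R by apply: convex_hull_sub; right.
have Ty z : (0 <= z <= 1)%R -> triangle R (0, z)%R.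
  move=> /andP[z0 z1].
  have := convex_set_avg (a := z) (b := (1 - z)%R) cT TA T0 z0.
  rewrite subr_ge0 => /(_ z1); rewrite addrC subrK => /(_ ltr01).
  by rewrite /= !mulr0 addr0 mulr1 !divr1 addr0.
(* For [x = 1] the point is the corner (1, 0); otherwise it lies on the segment from (1, 0) to (0, y
   / (1 - x)). *)
have [x1|x1] := eqVneq x 1%R.
  by rewrite x1 (_ : y = 0%R) //; move: xy1; rewrite x1; lra.
have x1' : (0 < 1 - x)%R by rewrite subr_gt0 lt_neqAle x1; lra.
have Tyx : triangle R (0, y / (1 - x))%R.
  apply: Ty; apply/andP; split; first by rewrite divr_ge0 // ltW.
  by rewrite ler_pdivrMr // mul1r; lra.
have := convex_set_avg (a := x) (b := (1 - x)%R) cT TC Tyx x0 (ltW x1').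
rewrite addrC subrK => /(_ ltr01) /=.
by rewrite !mulr0 mulr1 addr0 add0r !divr1 mulrC divfK // gt_eqF.
Qed.

(** The Booleans select the kind of the bounds, so that the open and the closed triangle are
    measured at once. *)
Lemma area_half (A : set (plane R)) (l r : bool) :
  (forall x y, A (x, y) <->
    x \in Interval (BSide l 0%R) (BSide r 1%R) /\
    y \in Interval (BSide l 0%R) (BSide r (1 - x)%R)) ->
  area A = (2^-1)%:E.
Proof.
move=> AE; rewrite /area /product_measure1 /=.
transitivity (\int[mu1]_(x in [set` Interval (BSide l 0%R) (BSide r 1%R)]) (1 - x)%:E).
  rewrite [RHS]integral_mkcond; apply: eq_integral => x _; rewrite /patch /= xsectionE.
  case: ifPn => [/set_mem /= xI|/negP xI].
    have -> : pair x @^-1` A = [set` Interval (BSide l 0%R) (BSide r (1 - x)%R)].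
      by apply/seteqP; split=> y /=; [move=> /AE[]|move=> yI; apply/AE].
    rewrite lebesgue_measure_itv /= lte_fin subr_gt0 oppr0 adde0.
    case: ltP => // x1; congr (_%:E).
    have : (x <= 1)%R by move: xI; rewrite in_itv => /andP[_]; case: (r) => //= /ltW.
    by move=> x1'; apply/eqP; rewrite eq_sym subr_eq0 eq_le x1 x1'.
  rewrite (_ : _ @^-1` _ = set0) ?measure0 //; apply/seteqP; split=> y //= /AE[xI' _].
  by apply: xI; apply/mem_set.
rewrite integral_itv_bndoo; last first.
  by apply/measurable_EFinP/measurable_funTS; exact: measurable_funB.
have := integral_monomial_oo 0 1.
under eq_integral do rewrite expr0 expr1 mul1r.
by move=> ->; congr (_%:E); rewrite /= mul1r.
Qed.

Lemma area_open_triangle : area [set` @open_triangle R] = (2^-1)%:E.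
Proof.
apply: (@area_half _ false true) => x y; rewrite !in_itv /=.
split=> [/and3P[/= x0 y0 xy]|[/andP[x0 x1] /andP[y0 y1]]].
  by split; apply/andP; split => //; lra.
by apply/and3P; split => //=; lra.
Qed.

Lemma area_triangle : area (triangle R) = (2^-1)%:E.
Proof.
apply: (@area_half _ true false) => x y; rewrite !in_itv /= triangleE /=.
split=> [[x0 y0 xy]|[/andP[x0 x1] /andP[y0 y1]]].
  by split; apply/andP; split => //; lra.
by split => //=; lra.
Qed.

Lemma measurable_open_triangle_set : measurable [set` @open_triangle R].
Proof.
rewrite -[X in measurable X]setTI.
exact: (measurable_open_triangle (R := R) measurableT (Y := [set true])).
Qed.

Lemma measurable_triangle : measurable (triangle R).
Proof.
have m1 := measurable_plane1 (@measurable_id _ (plane R) setT).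
have m2 := measurable_plane2 (@measurable_id _ (plane R) setT).
rewrite triangleE (_ : mkset _ = [set: plane R] `&`
   (fun p => [&& 0 <= p.1 :> R, 0 <= p.2 :> R & p.1 + p.2 <= 1 :> R]%R) @^-1` [set true]).
  suff : measurable_fun [set: plane R]
      (fun p => [&& 0 <= p.1 :> R, 0 <= p.2 :> R & p.1 + p.2 <= 1 :> R]%R) by apply.
  by apply: measurable_and; [|apply: measurable_and]; apply: measurable_fun_ler => //;
    exact: measurable_funD.
by rewrite setTI; apply/seteqP; split=> p /=; [move=> [-> -> ->]|move=> /and3P[]].
Qed.

(** The boundary is null because the open and the closed triangle have the same finite area. This
    allows the geometry to be done in the open triangle only. *)
Lemma area_setI_triangle (A : set (plane R)) : measurable A ->
  area (A `&` triangle R) = area (A `&` [set` @open_triangle R]).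
Proof.
move=> mA; have T0T : [set` @open_triangle R] `<=` triangle R.
  by move=> p; rewrite triangleE => /and3P[? ? ?]; split; exact: ltW.
have mT0 := measurable_open_triangle_set; have mT := measurable_triangle.
have null : area (triangle R `\` [set` @open_triangle R]) = 0.
  have -> : area (triangle R `\` [set` @open_triangle R]) =
      area (triangle R) - area (triangle R `&` [set` @open_triangle R]).
    apply: (@measureD _ _ _ (mu1 \x mu1)%E) => //.
    by rewrite [X in X < _](_ : _ = area (triangle R)) // area_triangle ltry.
  by rewrite setIidr // area_triangle area_open_triangle -EFinB subrr.
apply/eqP; rewrite eq_le; apply/andP; split; last first.
  by apply: le_measure; rewrite ?inE; [exact: measurableI|exact: measurableI|exact: setIS].
apply: (@le_trans _ _ (area (A `&` [set` @open_triangle R]) +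
    area (triangle R `\` [set` @open_triangle R]))); last by rewrite null adde0.
have mAT0 : measurable (A `&` [set` @open_triangle R]) by exact: measurableI.
have mTT0 : measurable (triangle R `\` [set` @open_triangle R]) by exact: measurableD.
apply: le_trans (@measureU2 _ _ _ (mu1 \x mu1)%E _ _ mAT0 mTT0).
apply: le_measure; rewrite ?inE.
- exact: measurableI.
- by apply: measurableU; [exact: measurableI|exact: measurableD].
- by move=> p [pA pT]; have [pT0|pT0] := pselect ([set` @open_triangle R] p); [left|right].
Qed.

End TriangleArea.

Local Close Scope ereal_scope.

(** * The uniform law on the triangle *)

Lemma right_of_open_triangle (R : realType) (x q : plane R) :
  open_triangle x -> right_of x q -> open_triangle q.
Proof.
move=> Tx /and3P[/= q1 q2 q12]; have /andP[c0 c1] := abscissa_itv Tx.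
have c1' : 0 < 1 - abscissa x by rewrite subr_gt0.
move: q1; rewrite pmulr_lgt0 ?invr_gt0 // => q1.
have q12' : q.1 - abscissa x + abscissa x * q.2 + q.2 * (1 - abscissa x) < 1 - abscissa x :> R.
  have := q12; rewrite -(ltr_pM2r c1') mulrDl divfK ?mul1r // gt_eqF //.
have q2' : q.2 < 1 :> R.
  by move: q12; apply: le_lt_trans; rewrite lerDr divr_ge0 // ltW.
apply/and3P; split => //; last by lra.
have : 0 < abscissa x * (1 - q.2) by rewrite mulr_gt0 // subr_gt0.
lra.
Qed.

Lemma measurable_inv (R : realType) : measurable_fun [set: R] (@GRing.inv R).
Proof.
have -> : [set: R] = [set 0] `|` ~` [set 0] by rewrite setUv.
apply/measurable_funU => //; first exact: measurableC.
split; first exact: measurable_fun_set1.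
apply: open_continuous_measurable_fun; first exact/closed_openC/closed_eq.
by move=> x /set_mem /eqP x0; exact: inv_continuous.
Qed.

Lemma measurable_abscissa (R : realType) : measurable_fun [set: plane R] (@abscissa R).
Proof.
have m1 := measurable_plane1 (@measurable_id _ (plane R) setT).
have m2 := measurable_plane2 (@measurable_id _ (plane R) setT).
apply: measurable_funM => //; apply: (measurableT_comp (@measurable_inv R)).
exact: measurable_funB.
Qed.

(* Given the first vertex [x], the probability that [m] given points lie above the chord from
   [x] to (1, 0) and [l] given points below it. *)
Definition chord_weight (R : realType) (m l : nat) (x : plane R) : R :=
  if open_triangle x then
    ((1 - abscissa x) * (1 - x.2)) ^+ m * ((1 - abscissa x) * x.2) ^+ l else 0.

Lemma chord_weight_ge0 (R : realType) m l (x : plane R) : 0 <= chord_weight m l x.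
Proof.
rewrite /chord_weight; case: ifP => // Tx.
have /and3P[? ? ?] := Tx; have /andP[? ?] := abscissa_itv Tx.
by rewrite mulr_ge0 // exprn_ge0 // mulr_ge0 //; lra.
Qed.

Lemma measurable_chord_weight (R : realType) m l :
  measurable_fun [set: plane R] (chord_weight m l).
Proof.
have m1 := measurable_plane1 (@measurable_id _ (plane R) setT).
have m2 := measurable_plane2 (@measurable_id _ (plane R) setT).
have mabs := @measurable_abscissa R.
apply: measurable_fun_ifT => //; first exact: measurable_open_triangle.
by apply: measurable_funM; apply: measurable_funX; apply: measurable_funM => //;
  exact: measurable_funB.
Qed.

Local Open Scope ereal_scope.

Section UniformLaw.
Context (R : realType) (mu : probability (plane R) R).
Notation area2 := (@lebesgue_measure R \x @lebesgue_measure R)%E.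
Notation T0 := [set` @open_triangle R].
Hypothesis muE : forall A, measurable A -> mu A = 2%:E * area (A `&` T0).
Implicit Types f : plane R -> \bar R.

Let mT0 : measurable T0 := @measurable_open_triangle_set R.

Lemma integral_uniform f : measurable_fun [set: plane R] f -> (forall q, 0 <= f q) ->
  \int[mu]_q f q = 2%:E * \int[area2]_q (f \_ T0) q.
Proof.
move=> mf f0; have mT0C : measurable (~` T0) by exact: measurableC.
have muT0C : mu (~` T0) = 0 by rewrite muE // setICl /area measure0 mule0.
rewrite (ge0_negligible_integral mT0C) // setTD setCK.
have -> : \int[mu]_(q in T0) f q = \int[mscale (2%:nng)%R area2]_(q in T0) f q.
  apply: eq_measure_integral => A mA AT0.
  by transitivity (2%:E * area (A `&` T0)); [exact: muE|rewrite setIidl].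
rewrite ge0_integral_mscale //; last exact: measurable_funTS.
by rewrite -integral_mkcond.
Qed.

(** On [T0] the law has constant density with respect to area, and [thT] places the preimage of [T0]
    inside [T0]; hence the scaling factor of [th] for area is also its factor for [mu]. *)
Lemma integral_uniform_preimage (th : plane R -> plane R) (k : R) :
  measurable_fun [set: plane R] th ->
  (forall q, open_triangle (th q) -> open_triangle q) ->
  (forall f, measurable_fun [set: plane R] f -> (forall q, 0 <= f q) ->
    \int[area2]_q f (th q) = k%:E * \int[area2]_q f q) ->
  forall f, (forall q, 0 <= f q) -> measurable_fun [set: plane R] f ->
  \int[mu]_(q in [set q | open_triangle (th q)]) f (th q) = k%:E * \int[mu]_q f q.
Proof.
move=> mth thT thk f f0 mf.
have mD : measurable [set q | open_triangle (th q)].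
  by have := mth measurableT _ mT0; rewrite setTI.
have fT0 q : 0 <= (f \_ T0) q by rewrite patchE; case: ifP.
have mfT0 : measurable_fun [set: plane R] (f \_ T0).
  by apply/(measurable_restrictT _ _).1 => //; apply: measurable_funTS.
rewrite integral_mkcond !integral_uniform //; last 2 first.
- apply/(measurable_restrictT _ _).1 => //; apply: measurable_funTS.
  exact: measurableT_comp.
- by move=> q; rewrite patchE; case: ifP.
rewrite muleCA -thk //; congr (_ * _); apply: eq_integral => q _; rewrite !patchE.
have -> : (q \in [set q | open_triangle (th q)]) = open_triangle (th q).
  by apply/idP/idP; rewrite inE.
rewrite !mem_setE; have [-> ->] : (q \in @open_triangle R) = open_triangle q /\
  (th q \in @open_triangle R) = open_triangle (th q) by [].
by case Tq : (open_triangle (th q)); [rewrite (thT _ Tq)|case: ifP].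
Qed.

Section FirstVertexIntegrals.
Variable x : plane R.
Hypothesis Tx : open_triangle x.

Let c1 : (abscissa x < 1)%R. Proof. by have /andP[] := abscissa_itv Tx. Qed.
Let x2 : (0 < x.2 :> R)%R. Proof. by have /and3P[] := Tx. Qed.

Lemma integral_below_chord f : (forall q, 0 <= f q) -> measurable_fun [set: plane R] f ->
  \int[mu]_(q in [set` below_chord x]) f (vscale x.2 (shear (abscissa x) q)) =
  ((1 - abscissa x) * x.2)%:E * \int[mu]_q f q.
Proof.
apply: (@integral_uniform_preimage (fun q => vscale x.2 (shear (abscissa x) q))).
- exact: measurableT_comp (measurable_vscale _) (measurable_shear _).
- by move=> q /(below_chord_right_of Tx); apply: right_of_open_triangle.
- move=> g mg g0.
  have mg' := measurableT_comp mg (measurable_vscale (x.2 : R)).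
  transitivity ((1 - abscissa x)%:E * \int[area2]_q g (vscale x.2 q)).
    exact: (ge0_integral_shear c1 mg' (fun q => g0 _)).
  by rewrite ge0_integral_vscale // EFinM muleA.
Qed.

Lemma uniform_right_of : mu [set` right_of x] = (1 - abscissa x)%:E.
Proof.
transitivity (\int[mu]_(q in [set q | open_triangle (shear (abscissa x) q)])
    cst 1 (shear (abscissa x) q)).
  rewrite integral_cst; first by rewrite mul1e.
  by have := measurable_shear (abscissa x) measurableT mT0; rewrite setTI.
rewrite (@integral_uniform_preimage (shear (abscissa x)) (1 - abscissa x)
  (measurable_shear _) (fun q => @right_of_open_triangle _ x q Tx) _ (cst 1)) //.
- by rewrite integral_cst // [X in _ * (_ * X)](probability_setT mu) !mule1.
- by move=> g mg g0; rewrite ge0_integral_shear.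
Qed.

Lemma measurable_right_of : measurable [set` right_of x].
Proof. by have := measurable_shear (abscissa x) measurableT mT0; rewrite setTI. Qed.

Lemma measurable_below_chord : measurable [set` below_chord x].
Proof.
have := measurableT_comp (measurable_vscale (x.2 : R)) (measurable_shear (abscissa x)) measurableT mT0.
by rewrite setTI.
Qed.

Lemma uniform_below_chord : mu [set` below_chord x] = ((1 - abscissa x) * x.2)%:E.
Proof.
transitivity (\int[mu]_(q in [set` below_chord x]) cst 1 (vscale x.2 (shear (abscissa x) q))).
  by rewrite integral_cst ?mul1e //; exact: measurable_below_chord.
by rewrite integral_below_chord // integral_cst // [X in _ * (_ * X)](probability_setT mu) !mule1.
Qed.

Let above_chordE : [set` fun q => right_of x q && ~~ below_chord x q] =
  [set` right_of x] `\` [set` below_chord x].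
Proof.
apply/seteqP; split=> q /=; rewrite -!topredE /=.
  by move=> /andP[-> /negP].
by move=> [-> /negP].
Qed.

Lemma measurable_above_chord : measurable [set` fun q => right_of x q && ~~ below_chord x q].
Proof.
rewrite above_chordE; apply: measurableD; [exact: measurable_right_of|exact: measurable_below_chord].
Qed.

Lemma uniform_above_chord :
  mu [set` fun q => right_of x q && ~~ below_chord x q] =
  ((1 - abscissa x) * (1 - x.2))%:E.
Proof.
rewrite above_chordE.
have mr := measurable_right_of; have mb := measurable_below_chord.
have -> : mu ([set` right_of x] `\` [set` below_chord x]) =
    mu [set` right_of x] - mu ([set` right_of x] `&` [set` below_chord x]).
  by apply: measureD => //; rewrite [X in X < _](_ : _ = mu [set` right_of x]) // uniform_right_of ltry.
rewrite setIidr; last by move=> q /(below_chord_right_of Tx).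
rewrite uniform_right_of uniform_below_chord -EFinB; congr (_%:E); ring.
Qed.

Lemma iterint_right_of n (h : seq (plane R) -> \bar R) :
  (forall s, 0 <= h s) -> seq_measurable (fun _ : unit => h) ->
  iterint mu n (fun s => if all (right_of x) s then
    h [seq vscale x.2 (shear (abscissa x) q) | q <- s & below_chord x q] else 0) =
  \sum_(l < n.+1) ('C(n, l)%:R * ((1 - abscissa x) * (1 - x.2)) ^+ (n - l) *
    ((1 - abscissa x) * x.2) ^+ l)%:E * iterint mu l h.
Proof.
move=> h0 mh; have x21 : (x.2 < 1 :> R)%R by have /and3P[] := Tx; lra.
rewrite -(@iterint_filter _ _ _ mu n (below_chord x)
  (fun q => right_of x q && ~~ below_chord x q)
  (fun q => vscale x.2 (shear (abscissa x) q)) h).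
- apply: eq_iterint => s _; congr (if _ then _ else _); apply: eq_all => q /=.
  by have := @below_chord_right_of _ x q Tx; case: below_chord => [->|_]; rewrite ?andbT.
- exact: measurable_below_chord.
- exact: measurable_above_chord.
- by move=> q ->; rewrite andbF.
- by rewrite mulr_ge0 // ltW // subr_gt0.
- by rewrite mulr_ge0 // ltW // subr_gt0.
- exact: uniform_above_chord.
- by move=> f f0 mf; exact: integral_below_chord.
- exact: measurableT_comp (measurable_vscale _) (measurable_shear _).
- exact: h0.
- exact: mh.
Qed.

End FirstVertexIntegrals.

(** At height y the substitution x = (1 - y) u, with u the abscissa, separates the integrand into (1
    - u)^(m + l) and (1 - y)^m y^l; its Jacobian raises the exponent of 1 - y to m + 1. The two
    factors integrate to 1 / (m + l + 1) and to a Beta value, and the leading 2 is the density. *)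
Lemma integral_chord_weight m l :
  \int[mu]_x (chord_weight m l x)%:E =
  (2 * l`!%:R * m.+1`!%:R / ((m + l).+1%:R * (m + l).+2`!%:R))%R%:E.
Proof.
have g0 := @chord_weight_ge0 R m l; have mg := @measurable_chord_weight R m l.
rewrite (@integral_uniform (EFin \o chord_weight m l)); last 2 first.
- exact/measurable_EFinP.
- by move=> x; rewrite lee_fin.
have -> : (EFin \o chord_weight m l) \_ T0 = EFin \o chord_weight m l.
  apply/funext => x; rewrite patchE mem_setE.
  have -> : (x \in @open_triangle R) = open_triangle x by [].
  by rewrite /chord_weight /=; case: (open_triangle x).
rewrite fubini_tonelli2; last 2 first.
- exact/measurable_EFinP.
- by move=> x; rewrite lee_fin.
transitivity (2%:E * ((m + l).+1%:R^-1%:E *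
    \int[@lebesgue_measure R]_(y in `]0%R, 1%R[) (y ^+ l * (1 - y) ^+ m.+1)%:E)).
  congr (_ * _); rewrite [in RHS]integral_mkcond -ge0_integralZl ?lee_fin //; last 2 first.
  - apply/(measurable_restrictT _ _).1 => //; apply/measurable_EFinP/measurable_funTS.
    by apply: measurable_funM; apply: measurable_funX => //; exact: measurable_funB.
  - move=> y _; rewrite patchE; case: ifP => // /set_mem/=; rewrite in_itv /= => /andP[y0 y1].
    by rewrite lee_fin mulr_ge0 // exprn_ge0 //; lra.
  apply: eq_integral => y _; rewrite /fubini_G /patch mem_setE in_itv /=.
  case: ifPn => [|/negP y01]; last first.
     rewrite mule0; apply: integral0_eq => x _ /=; rewrite /chord_weight; case: ifP => // /and3P[/= x0 y0 xy].
    by exfalso; apply: y01; apply/andP; split; lra.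
  move=> /andP[y0 y1]; have y1' : (0 < 1 - y)%R by rewrite subr_gt0.
  (* The weight at height [y] as a function of the abscissa [u]. *)
  pose F (u : R) : R := (if 0 < u < 1 then ((1 - u) * (1 - y)) ^+ m * ((1 - u) * y) ^+ l else 0)%R.
  transitivity (\int[@lebesgue_measure R]_x (F ((1 - y)^-1 * x + 0)%R)%:E).
    apply: eq_integral => x _; congr (_%:E); rewrite /chord_weight /F /open_triangle /= addr0.
    rewrite y0 /= (mulrC _ x) pmulr_lgt0 ?invr_gt0 // ltr_pdivrMr // mul1r /abscissa /=.
    by rewrite (_ : (x < 1 - y) = (x + y < 1))%R // ltrBrDr.
  have F0 u : (0 <= F u)%R.
    by rewrite /F; case: ifP => // /andP[? ?]; rewrite mulr_ge0 // exprn_ge0 // mulr_ge0 //; lra.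
  have mF : measurable_fun [set: R] F.
    apply: measurable_fun_ifT => //.
      by apply: measurable_and; apply: measurable_fun_ltr.
    by apply: measurable_funM; apply: measurable_funX; apply: measurable_funM => //; exact: measurable_funB.
  have y1V : (0 < (1 - y)^-1)%R by rewrite invr_gt0.
  have mEF : measurable_fun [set: R] (EFin \o F) by exact/measurable_EFinP.
  have EF0 u : 0 <= (EFin \o F) u by rewrite lee_fin.
  rewrite (ge0_integral_affine 0 y1V mEF EF0).
  rewrite invrK.
  have -> : \int[@lebesgue_measure R]_u (EFin \o F) u =
      ((1 - y) ^+ m * y ^+ l)%:E * \int[@lebesgue_measure R]_(u in `]0%R, 1%R[)
        (u ^+ 0 * (1 - u) ^+ (m + l))%:E.
    rewrite [in RHS]integral_mkcond -ge0_integralZl ?lee_fin //.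
    - apply: eq_integral => u _; rewrite /patch mem_setE /= /F in_itv /=.
      case: ifP => _; last by rewrite mule0.
      by rewrite -EFinM; congr (_%:E); rewrite !exprMn exprD expr0; ring.
    - apply/(measurable_restrictT _ _).1 => //; apply/measurable_EFinP/measurable_funTS.
      by apply: measurable_funM; apply: measurable_funX => //; exact: measurable_funB.
    - move=> u _; rewrite patchE; case: ifP => // /set_mem/=; rewrite in_itv /= => /andP[? ?].
      by rewrite lee_fin mulr_ge0 // exprn_ge0 //; lra.
    - by rewrite mulr_ge0 // exprn_ge0 // ltW.
  rewrite integral_monomial_oo -!EFinM; congr (_%:E).
  rewrite fact0 mul1n add0n factS natrM exprS.
  have fact_neq0 : (m + l)`!%:R != 0%R :> R by rewrite pnatr_eq0 -lt0n fact_gt0.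
  have succ_neq0 : (m + l).+1%:R != 0%R :> R by rewrite pnatr_eq0.
  move: y {y0 y1 y1' F F0 mF y1V mEF EF0} => y.
  move: (m + l)`!%:R (m + l).+1%:R fact_neq0 succ_neq0 => u v u0 v0.
  suff key (z a b : R) : ((1 - z) * (a * b * (u / (v * u))) = v^-1 * (b * ((1 - z) * a)))%R.
    exact: key.
  by field; rewrite u0 v0.
rewrite integral_monomial_oo -!EFinM; congr (_%:E).
rewrite (_ : (l + m.+1).+1 = (m + l).+2)%N; last by rewrite addnS addnC.
rewrite natrM invfM; ring.
Qed.

End UniformLaw.

Local Close Scope ereal_scope.

(** * Buchta's recursion *)

Definition first_vertex_at (R : realType) (i : nat) (s : seq (plane R)) : bool :=
  first_vertex (nth point s i) (take i s ++ drop i.+1 s).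

Lemma first_vertex_at_insert (R : realType) (i : nat) (x : plane R) (s : seq (plane R)) :
  (i <= size s)%N -> first_vertex_at i (take i s ++ x :: drop i s) = first_vertex x s.
Proof.
move=> si; rewrite /first_vertex_at nth_cat size_takel // ltnn subnn /=.
rewrite take_cat size_takel // ltnn subnn take0 cats0.
by rewrite drop_cat size_takel // ltnNge leqnSn /= subSnn /= drop0 cat_take_drop.
Qed.

Lemma first_vertex_at_inj (R : realType) (s : seq (plane R)) i j :
  (i < size s)%N -> (j < size s)%N -> first_vertex_at i s -> first_vertex_at j s -> i = j.
Proof.
have lt_abscissa k l : (k < size s)%N -> (l < size s)%N -> k != l -> first_vertex_at k s ->
    abscissa (nth point s k) < abscissa (nth point s l).
  move=> ks ls kl /andP[Tx /allP sx]; apply: abscissa_right_of Tx (sx _ _).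
  rewrite mem_cat; have [lk|kl'] := ltnP l k.
    by rewrite -(nth_take point lk) mem_nth // size_takel // ltnW.
  have {kl' kl} kl : (k < l)%N by rewrite ltn_neqAle kl.
  apply/orP; right; rewrite -(subnKC kl) -nth_drop mem_nth // size_drop.
  by rewrite ltn_sub2r // (leq_ltn_trans kl).
move=> is_ js fi fj; apply/eqP/negPn/negP => ij.
have := lt_abscissa _ _ is_ js ij fi; rewrite eq_sym in ij.
by move=> /(lt_trans (lt_abscissa _ _ js is_ ij fj)); rewrite ltxx.
Qed.

Lemma measurable_right_of_pair (R : realType) d (Y : measurableType d) (e e' : Y -> plane R) :
  measurable_fun [set: Y] e -> measurable_fun [set: Y] e' ->
  measurable_fun [set: Y] (fun y => right_of (e y) (e' y)).
Proof.
move=> me me'; have mc := measurableT_comp (@measurable_abscissa R) me.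
apply: (measurableT_comp (@measurable_open_triangle R)).
have m1 : measurable_fun [set: Y] (fun y => ((e' y).1 - abscissa (e y) + abscissa (e y) * (e' y).2) /
    (1 - abscissa (e y)) : R).
  have m1 := measurable_plane1 me'; have m2 := measurable_plane2 me'.
  apply: measurable_funM; last first.
    by apply: (measurableT_comp (@measurable_inv R)); exact: measurable_funB.
  by apply: measurable_funD; [exact: measurable_funB|exact: measurable_funM].
by apply/measurable_fun_pairP; split; [exact: m1|exact: (measurable_plane2 me')].
Qed.

Lemma seq_measurable_first_vertex_at (R : realType) i :
  seq_measurable (fun (_ : unit) (s : seq (plane R)) => first_vertex_at i s).
Proof.
move=> d Y f n F _ mF.
have mn := mF.2 i.
have mc : measurable_seq (minn i n + (n - i.+1)) (fun y => take i (F y) ++ drop i.+1 (F y)).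
  by apply: measurable_seq_cat; [exact: measurable_seq_take|exact: measurable_seq_drop].
apply: measurable_and; first exact: measurableT_comp (@measurable_open_triangle R) mn.
by apply: (measurable_all _ mc) => e me; exact: measurable_right_of_pair.
Qed.

Local Open Scope ereal_scope.

Lemma seq_measurable_EFin_bool d (E : measurableType d) (R : realType) (Q : seq E -> bool) :
  seq_measurable (fun _ : unit => Q) ->
  seq_measurable (fun (_ : unit) s => (Q s)%:R%:E : \bar R).
Proof.
move=> mQ d1 Y f m F mf mF; apply/measurable_EFinP.
rewrite (_ : (fun y => _) = (fun y => if Q (F y) then 1%R else 0%R)); last first.
  by apply/funext => y; case: (Q _).
by apply: measurable_fun_ifT => //; exact: (mQ _ _ f m).
Qed.

Lemma seq_measurable_if d (E : measurableType d) (R : realType) (Q : seq E -> bool)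
    (h h' : seq E -> \bar R) :
  seq_measurable (fun _ : unit => Q) -> seq_measurable (fun _ : unit => h) ->
  seq_measurable (fun _ : unit => h') ->
  seq_measurable (fun (_ : unit) s => if Q s then h s else h' s).
Proof.
move=> mQ mh mh' d1 Y f m F mf mF.
by apply: measurable_fun_ifT; [exact: (mQ _ _ f m)|exact: (mh _ _ f m)|exact: (mh' _ _ f m)].
Qed.

Lemma seq_measurable_cst d (E : measurableType d) (R : realType) (c : \bar R) :
  seq_measurable (fun (_ : unit) (_ : seq E) => c).
Proof. by move=> d1 Y f m F mf mF; exact: measurable_cst. Qed.

(** Normalises the recursion: its weights add up to 1. *)
Lemma sum_subn m : ((\sum_(l < m) (m - l)).*2 = m * m.+1)%N.
Proof.
elim: m => [|m IHm]; first by rewrite big_ord0.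
rewrite big_ord_recl /= subn0 doubleD.
rewrite (eq_bigr (fun l : 'I_m => (m - l)%N)) ?IHm; first by lia.
by move=> l _; rewrite /bump /= add1n subSS.
Qed.

Section FirstVertexDecomposition.
Context (R : realType) (mu : probability (plane R) R).
Hypothesis muE : forall A, measurable A ->
  mu A = 2%:E * area (A `&` [set` @open_triangle R]).
Implicit Types h : seq (plane R) -> \bar R.

(** Integration over the position [x] of the first vertex turns the binomial weights into explicit
    ones; they do not depend on [i], by exchangeability. [h] and [h'] stay abstract because the
    identity serves both for the total mass, with both equal to 1, and for the vertex counts. *)
Lemma iterint_first_vertex_at n i h h' : (i <= n)%N ->
  (forall s, 0 <= h s) -> seq_measurable (fun _ : unit => h) ->
  (forall s, 0 <= h' s) -> seq_measurable (fun _ : unit => h') ->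
  (forall x s t, first_vertex x s -> t =i x :: s ->
    h t = h' [seq vscale x.2 (shear (abscissa x) q) | q <- s & below_chord x q]) ->
  iterint mu n.+1 (fun s => if first_vertex_at i s then h s else 0) =
  \sum_(l < n.+1) (2 * (n.+1 - l)%:R / (n.+1 * (n.+1 * n.+2))%:R)%R%:E * iterint mu l h'.
Proof.
move=> ni h0 mh h'0 mh' hh'.
rewrite (@iterint_insert _ _ _ mu n i) //; last 2 first.
- by move=> s; case: ifP.
- exact: (seq_measurable_if (@seq_measurable_first_vertex_at R i) mh (@seq_measurable_cst _ _ R 0)).
transitivity (\int[mu]_x \sum_(l < n.+1)
    (('C(n, l)%:R)%:E * (chord_weight (n - l) l x)%:E) * iterint mu l h').
  apply: eq_integral => x _.
  transitivity (iterint mu n (fun s => if open_triangle x && all (right_of x) s then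
      h' [seq vscale x.2 (shear (abscissa x) q) | q <- s & below_chord x q] else 0)).
    apply: eq_iterint => s sn; rewrite first_vertex_at_insert ?sn //.
    rewrite -[_ && _]/(first_vertex x s); case: ifP => // fx; apply: hh' => // q.
    by rewrite mem_cat in_cons orbCA -mem_cat cat_take_drop in_cons.
  have [Tx|nTx] /= := boolP (open_triangle x); last first.
    rewrite (iterint_cst mu n 0) big1 // => l _.
    by rewrite /chord_weight (negbTE nTx) mule0 mul0e.
  rewrite (iterint_right_of muE Tx) //; apply: eq_bigr => l _; rewrite /chord_weight Tx.
  by rewrite -EFinM -mulrA.
have mw l : measurable_fun [set: plane R]
    (fun x => ('C(n, l)%:R)%:E * (chord_weight (n - l) l x)%:E).
  by apply: measurable_funeM; apply/measurable_EFinP; exact: measurable_chord_weight.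
have w0 l x : 0 <= ('C(n, l)%:R)%:E * (chord_weight (n - l) l x)%:E.
  by rewrite mule_ge0 ?lee_fin ?ler0n ?chord_weight_ge0.
rewrite ge0_integral_sum //; last 2 first.
- move=> l; under eq_fun do rewrite muleC.
  exact: measurable_funeM.
- by move=> l x _; rewrite mule_ge0 ?iterint_ge0.
apply: eq_bigr => l _; rewrite ge0_integralZr ?iterint_ge0 //; congr (_ * _).
rewrite ge0_integralZl ?lee_fin ?ler0n //; last 2 first.
- by apply/measurable_EFinP; exact: measurable_chord_weight.
- by move=> x _; rewrite lee_fin chord_weight_ge0.
rewrite (integral_chord_weight muE) -EFinM; congr (_%:E).
have ln : (l <= n)%N by rewrite -ltnS.
rewrite (subnK ln) (subSn ln) !factS !natrM.
have := congr1 (fun k => k%:R : R)%R (bin_fact ln); rewrite !natrM.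
have : (n`!%:R != 0 :> R)%R by rewrite pnatr_eq0 -lt0n fact_gt0.
have : (n.+1%:R != 0 :> R)%R by rewrite pnatr_eq0.
have : (n.+2%:R != 0 :> R)%R by rewrite pnatr_eq0.
move: (n.+2%:R)%R (n.+1%:R)%R (n`!%:R)%R ((n - l).+1%:R)%R ('C(n, l)%:R)%R (l`!%:R)%R ((n - l)`!%:R)%R.
move=> f e g d a b c f0 e0 g0 E; move: g0; rewrite -E !mulf_eq0 !negb_or => /and3P[a0 b0 c0].
by field; rewrite a0 b0 c0 e0 f0.
Qed.

Lemma sum_first_vertex_at h s :
  \sum_(i < size s) (if first_vertex_at i s then h s else 0) =
  if has (fun i => first_vertex_at i s) (iota 0 (size s)) then h s else 0.
Proof.
case: ifPn => [/hasP[i]|/hasPn nf]; last first.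
  by apply: big1 => i _; rewrite (negbTE (nf _ _)) // mem_iota ltn_ord.
rewrite mem_iota /= add0n => is_ fi.
rewrite (bigD1 (Ordinal is_)) //= fi big1 ?adde0 // => j ji; case: ifP => // fj.
by move: ji; rewrite (_ : j = Ordinal is_) ?eqxx //; apply/val_inj/(first_vertex_at_inj _ _ fj fi).
Qed.

(* The total mass of the events "the i-th point is the first vertex" is 1, so that almost
   surely exactly one of them occurs; no degenerate configuration has to be discussed. *)
Lemma iterint_first_vertex n (Q : seq (plane R) -> bool) :
  seq_measurable (fun _ : unit => Q) ->
  iterint mu n.+1 (fun s => (Q s)%:R%:E) =
  \sum_(i < n.+1) iterint mu n.+1 (fun s => if first_vertex_at i s then (Q s)%:R%:E else 0).
Proof.
pose ex (s : seq (plane R)) := has (fun i => first_vertex_at i s) (iota 0 n.+1).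
have sum_ex (Q' : seq (plane R) -> bool) : seq_measurable (fun _ : unit => Q') ->
    \sum_(i < n.+1) iterint mu n.+1 (fun s => if first_vertex_at i s then (Q' s)%:R%:E else 0) =
    iterint mu n.+1 (fun s => if ex s then (Q' s)%:R%:E else 0).
  move=> mQ'; rewrite -iterint_sum.
  - apply: eq_iterint => s sn.
    by have := sum_first_vertex_at (fun s => (Q' s)%:R%:E) s; rewrite sn.
  - by move=> i s; case: ifP; rewrite ?lee_fin.
  - move=> i; apply: (seq_measurable_if (@seq_measurable_first_vertex_at R i) _ (@seq_measurable_cst _ _ R 0)).
    exact: seq_measurable_EFin_bool.
have mex : seq_measurable (fun _ : unit => ex).
  move=> d Y f m F mf mF; rewrite /ex; elim: (iota 0 n.+1) => [|i l IHl] /=.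
    exact: measurable_cst.
  by apply: measurable_or => //; exact: (@seq_measurable_first_vertex_at R i _ _ f m).
move=> mQ; rewrite sum_ex //.
have mT : seq_measurable (fun (_ : unit) (_ : seq (plane R)) => true).
  by move=> d Y f m F mf mF; exact: measurable_cst.
have split_ex (Q' : seq (plane R) -> bool) : seq_measurable (fun _ : unit => Q') ->
    iterint mu n.+1 (fun s => (Q' s)%:R%:E) =
    iterint mu n.+1 (fun s => if ex s then (Q' s)%:R%:E else 0) +
    iterint mu n.+1 (fun s => if ex s then 0 else (Q' s)%:R%:E).
  move=> mQ'; rewrite -iterintD.
  - by apply: eq_iterint => s _; case: ifP; rewrite ?adde0 ?add0e.
  - by move=> s; case: ifP; rewrite ?lee_fin.
  - by apply: (seq_measurable_if mex _ (@seq_measurable_cst _ _ R 0)); exact: seq_measurable_EFin_bool.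
  - by move=> s; case: ifP; rewrite ?lee_fin.
  - by apply: (seq_measurable_if mex (@seq_measurable_cst _ _ R 0)); exact: seq_measurable_EFin_bool.
have null : iterint mu n.+1 (fun s => if ex s then 0 else 1) = 0.
  have := split_ex xpredT mT; rewrite -sum_ex //.
  rewrite (iterint_cst mu n.+1 1).
  have -> : \sum_(i < n.+1) iterint mu n.+1
      (fun s => if first_vertex_at i s then (true%:R : R)%:E else 0) = 1.
    have mc : seq_measurable (fun (_ : unit) (_ : seq (plane R)) => 1 : \bar R).
      exact: seq_measurable_cst.
    rewrite (eq_bigr (fun=> (n.+1%:R^-1)%R%:E)).
      by rewrite sumEFin sumr_const card_ord -[(_ *+ _)%R]mulr_natr mulVf ?pnatr_eq0.
    move=> i _; have ni : (i <= n)%N by rewrite -ltnS.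
    rewrite (@iterint_first_vertex_at n i (fun=> 1) (fun=> 1) ni (fun=> lee01) mc
      (fun=> lee01) mc (fun _ _ _ _ _ => erefl)).
    rewrite (eq_bigr (fun l : 'I_n.+1 => ((2 / (n.+1 * (n.+1 * n.+2))%:R) * (n.+1 - l)%:R)%R%:E)).
      rewrite sumEFin -mulr_sumr -natr_sum; congr (_%:E).
      have := congr1 (fun k => k%:R : R)%R (sum_subn n.+1); rewrite -muln2 !natrM => E.
      have e0 : (n.+1%:R != 0 :> R)%R by rewrite pnatr_eq0.
      have f0 : (n.+2%:R != 0 :> R)%R by rewrite pnatr_eq0.
      move: E; move: (\sum_(l < n.+1) (n.+1 - l))%N%:R%R n.+1%:R%R n.+2%:R%R e0 f0 => S e f e0 f0 E.
      have -> : S = (e * f / 2)%R by rewrite -E mulfK // pnatr_eq0.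
      by field; rewrite e0 f0.
    by move=> l _; rewrite (iterint_cst mu l 1) mule1 mulrAC.
  (* The equation reads 1 = 1 + r, so the remaining mass is finite and equal to 0. *)
  move: (iterint _ _ _) => [r| |] // [E].
  by congr (_%:E); move: E; lra.
rewrite split_ex // [X in _ + X](_ : _ = 0) ?adde0 //.
have m0 := @seq_measurable_cst _ (plane R) R 0.
have mQE := @seq_measurable_EFin_bool _ _ R _ mQ.
apply/eqP; rewrite eq_le; apply/andP; split; last first.
  by apply: iterint_ge0 => s; case: ifP; rewrite ?lee_fin.
apply: (@le_trans _ _ (iterint mu n.+1 (fun s => if ex s then 0 else 1))); last by rewrite null.
apply: le_iterint.
- by move=> s; case: ifP; rewrite ?lee_fin.
- exact: seq_measurable_if mex m0 mQE.
- exact: (seq_measurable_if mex m0 (@seq_measurable_cst _ _ R 1)).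
- by move=> s; case: ifP => // _; case: (Q s); rewrite lee_fin.
Qed.

Definition vertex_prob (n k : nat) : \bar R :=
  iterint mu n (fun s => (vertex_count s == k)%:R%:E).

Lemma vertex_prob0 k : vertex_prob 0 k = (k == 0)%:R%:E.
Proof. by rewrite /vertex_prob /iterint /vertex_count /= eq_sym. Qed.

Lemma vertex_count_first_eq_mem (x : plane R) (s t : seq (plane R)) : first_vertex x s -> t =i x :: s ->
  vertex_count t = (vertex_count
    [seq vscale x.2 (shear (abscissa x) q) | q <- s & below_chord x q]).+1.
Proof. by move=> fx /vertex_count_eq_mem ->; apply: vertex_count_first. Qed.

Lemma seq_measurable_vertex_prob k :
  seq_measurable (fun (_ : unit) (s : seq (plane R)) => (vertex_count s == k)%:R%:E : \bar R).
Proof. exact/seq_measurable_EFin_bool/seq_measurable_vertex_count. Qed.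

Lemma vertex_probS0 n : vertex_prob n.+1 0 = 0.
Proof.
rewrite /vertex_prob iterint_first_vertex; last exact: seq_measurable_vertex_count.
apply: big1 => i _; have ni : (i <= n)%N by rewrite -ltnS.
(* In the presence of a first vertex the count is a successor, so the event of having no vertex
   contributes 0. *)
rewrite (iterint_first_vertex_at (h' := fun=> 0) ni).
- by rewrite big1 // => l _; rewrite (iterint_cst mu l 0) mule0.
- by move=> s; rewrite lee_fin.
- exact: seq_measurable_vertex_prob.
- by [].
- exact: seq_measurable_cst.
- by move=> x s t fx tE; rewrite (vertex_count_first_eq_mem fx tE).
Qed.

(* Buchta's formula, as a recursion on the first vertex. *)
Lemma vertex_probSS n k : vertex_prob n.+1 k.+1 =
  \sum_(l < n.+1) (2 * (n.+1 - l)%:R / (n.+1 * n.+2)%:R)%R%:E * vertex_prob l k.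
Proof.
rewrite /vertex_prob iterint_first_vertex; last exact: seq_measurable_vertex_count.
transitivity (\sum_(i < n.+1) \sum_(l < n.+1)
   (2 * (n.+1 - l)%:R / (n.+1 * (n.+1 * n.+2))%:R)%R%:E * vertex_prob l k).
  apply: eq_bigr => i _; have ni : (i <= n)%N by rewrite -ltnS.
  apply: (iterint_first_vertex_at ni).
  - by move=> s; rewrite lee_fin.
  - exact: seq_measurable_vertex_prob.
  - by move=> s; rewrite lee_fin.
  - exact: seq_measurable_vertex_prob.
  - by move=> x s t fx tE; rewrite (vertex_count_first_eq_mem fx tE).
rewrite exchange_big; apply: eq_bigr => l _ /=.
rewrite -ge0_sume_distrl; last by move=> i _; rewrite lee_fin divr_ge0 // mulr_ge0.
congr (_ * _); rewrite sumEFin sumr_const card_ord -[(_ *+ _)%R]mulr_natr; congr (_%:E).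
rewrite [in LHS]natrM invfM mulrA mulrAC -[RHS]mulr1 -!mulrA; congr (_ * (_ * _))%R.
by rewrite mulrA mulVf ?pnatr_eq0 // mulrC.
Qed.

Lemma vertex_prob_gt n k : (n < k)%N -> vertex_prob n k = 0.
Proof.
move=> nk; rewrite /vertex_prob -[RHS](iterint_cst mu n 0); apply: eq_iterint => s sn.
rewrite ltn_eqF // (leq_ltn_trans _ nk) // -sn.
exact: leq_trans (count_size _ _) (size_undup _).
Qed.

Lemma vertex_prob_fin_num n k : vertex_prob n k \is a fin_num.
Proof.
have p0 : 0 <= vertex_prob n k by apply: iterint_ge0 => s; rewrite lee_fin.
rewrite ge0_fin_numE // (@le_lt_trans _ _ 1) ?ltry // -(iterint_cst mu n 1).
apply: le_iterint.
- by move=> s; rewrite lee_fin.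
- exact: seq_measurable_vertex_prob.
- exact: seq_measurable_cst.
- by move=> s; rewrite lee_fin; case: (_ == _).
Qed.

End FirstVertexDecomposition.

Local Close Scope ereal_scope.

Lemma uniform_triangleE (R : realType) d (Omega : measurableType d) (P : probability Omega R)
    (X : {RV P >-> plane R}) (A : set (plane R)) :
  uniformly_distributed (triangle R) X -> measurable A ->
  distribution P X A = (2%:E * area (A `&` [set` @open_triangle R]))%E.
Proof. by move=> uX mA; rewrite uX // area_triangle area_setI_triangle // invrK muleC. Qed.

(** * The generating function and its recursion *)

Section GeneratingFunction.
Context (R : realType) (mu : probability (plane R) R).
Hypothesis muE : forall A, measurable A ->
  mu A = (2%:E * area (A `&` [set` @open_triangle R]))%E.

(** Unlike the sum in [prob_gen_fun], this one starts at [k = 0], which gives the value 1 for the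
    empty sample; for positive [n] the extra coefficient vanishes. *)
Definition vertex_poly (n : nat) : {poly R} := \poly_(k < n.+1) fine (vertex_prob mu n k).

Lemma coef_vertex_poly n k : (vertex_poly n)`_k = fine (vertex_prob mu n k).
Proof. by rewrite coef_poly; case: ltnP => // nk; rewrite vertex_prob_gt. Qed.

Lemma vertex_poly0 : vertex_poly 0 = 1.
Proof. by apply/polyP => k; rewrite coef_vertex_poly vertex_prob0 coef1. Qed.

Lemma vertex_poly_recursion n :
  (n * n.+1)%:R * vertex_poly n = 2%:R * 'X * \sum_(l < n) (n - l)%:R * vertex_poly l.
Proof.
apply/polyP => k; rewrite -mulrA -!scale_natr !coefZ coefXM coef_vertex_poly.
case: n => [|n]; first by rewrite mul0n mul0r big_ord0 coef0 if_same mulr0.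
case: k => [|k] /=; first by rewrite vertex_probS0 // !mulr0.
rewrite vertex_probSS // -sum_fine /=; last by move=> l _; rewrite fin_numM // vertex_prob_fin_num.
rewrite coef_sum !mulr_sumr; apply: eq_bigr => l _.
rewrite -scale_natr coefZ coef_vertex_poly fineM ?vertex_prob_fin_num //=.
rewrite !mulrA; congr (_ * _).
by rewrite -!mulrA mulrC -!mulrA mulVf ?pnatr_eq0 // mulr1.
Qed.

End GeneratingFunction.

Theorem theorem4 (R : realType) (d : measure_display)
    (Omega : measurableType d) (P : probability Omega R)
    (n : nat) (n_gt0 : (0 < n)%N) (X : 'I_n -> {RV P >-> plane R})
    (indepX : mutually_independent X)
    (unifX : forall i : 'I_n, uniformly_distributed (triangle R) (X i)) :
  let G := prob_gen_fun P (fun w => f0 (fun i : 'I_n => X i w)) n in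
  size G = n.+1 /\
  exists s : seq R,
    [/\ size s = n, uniq s, (forall x : R, root G x = (x \in s))
      & (forall x : R, x \in s -> x <= 0)].
Proof.
(* As [n] is positive, the law of one of the given points can serve as the uniform law on T, and all
   the others share it. *)
pose mu : probability (plane R) R := distribution P (X (Ordinal n_gt0)).
have muE A : measurable A -> mu A = (2%:E * area (A `&` [set` @open_triangle R]))%E.
  exact: uniform_triangleE.
have lawX i A : measurable A -> distribution P (X i) A = mu A.
  by move=> mA; rewrite muE //; exact: uniform_triangleE.
move=> G; suff -> : G = vertex_poly mu n.
  exact: convolution_recursion_real_rooted (vertex_poly0 mu) (vertex_poly_recursion muE) _ n_gt0.
have probE k : P [set w | f0 (fun i => X i w) = k] = vertex_prob mu n k.
  rewrite /vertex_prob -(@probability_independent_sample _ _ R _ Omega P mu n X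
    (fun s => vertex_count s == k) indepX lawX (seq_measurable_vertex_count k)).
  by congr (P _); apply/seteqP; split=> w /=; rewrite f0_vertex_count => /eqP.
rewrite /G /prob_gen_fun /vertex_poly poly_def big_add1 /= big_mkord big_ord_recl.
have -> : vertex_prob mu n 0 = 0%E by rewrite -[X in vertex_prob _ X](prednK n_gt0) vertex_probS0.
rewrite /= scale0r add0r; apply: eq_bigr => k _; rewrite probE //.
Qed.
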